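(* For any $1<p_1, p_2 \leq 2$, the projective tensor product $L_{p_1}[0,1] \widehat{\otimes}_\pi L_{p_2}[0,1]$ is strongly weakly compactly generated (SWCG).
   Context: A Banach space $Z$ is strongly weakly compactly generated (SWCG) if there is a weakly compact set $G \subseteq Z$ such that for every weakly compact set $K \subseteq Z$ and every $\varepsilon>0$ there is $n\in \mathbb{N}$ such that $K \subseteq nG + \varepsilon B_Z$, where $B_Z$ is the closed unit ball of $Z$. $\widehat{\otimes}_\pi$ denotes the projective tensor product of Banach spaces. *)

(* Defs.v *)
From HB Require Import structures.
From mathcomp Require Import all_boot all_order all_algebra.
From mathcomp Require Import sesquilinear ring_quotient.
From mathcomp Require Import all_classical all_reals all_analysis.
From mathcomp Require Import ess_sup_inf measurable_realfun hoelder.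

Set Implicit Arguments.
Unset Strict Implicit.
Unset Printing Implicit Defensive.

Import Order.TTheory GRing.Theory Num.Theory.
Import numFieldNormedType.Exports.

Local Open Scope classical_set_scope.
Local Open Scope ring_scope.

Record seminorm (R : realType) (V : lmodType R) := Seminorm {
  seminorm_fun :> V -> R;
  seminormD : forall x y, seminorm_fun (x + y) <= seminorm_fun x + seminorm_fun y;
  seminormZ : forall (a : R) x, seminorm_fun (a *: x) = `|a| * seminorm_fun x }.

Section SeminormTheory.
Context (R : realType) (V : lmodType R) (p : seminorm V).

Lemma seminorm0 : p 0 = 0.
Proof. by rewrite -(scale0r 0) seminormZ normr0 mul0r. Qed.

Lemma seminormN x : p (- x) = p x.
Proof. by rewrite -scaleN1r seminormZ normrN1 mul1r. Qed.

Lemma seminorm_ge0 x : 0 <= p x.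
Proof.
have := seminormD p x (- x); rewrite subrr seminorm0 seminormN -mulr2n.
by rewrite pmulrn_lge0.
Qed.

Lemma seminormB x y : p (x - y) = p (y - x).
Proof. by rewrite -opprB seminormN. Qed.

Lemma seminorm_dist x y z : p (x - z) <= p (x - y) + p (y - z).
Proof. by rewrite (le_trans _ (seminormD _ _ _))// addrA subrK. Qed.

Lemma seminorm_lip x y : `|p x - p y| <= p (x - y).
Proof.
rewrite ler_norml; apply/andP; split.
  by rewrite lerNl opprB lerBlDr seminormB (le_trans _ (seminormD _ _ _))// subrK.
by rewrite lerBlDr (le_trans _ (seminormD _ _ _))// subrK.
Qed.

End SeminormTheory.

(* The (Hausdorff) completion of (V, p): Cauchy sequences modulo null sequences,
   normed by [u] |-> lim_n p (u n). *)
Section Completion.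
Context (R : realType) (V : lmodType R) (p : seminorm V).

Definition cauchy_seqs : {pred nat -> V} := fun u =>
  `[< forall e, 0 < e ->
        exists N, forall m n, (N <= m)%N -> (N <= n)%N -> p (u m - u n) < e >].

Lemma cauchy_seqs_submod : submod_closed cauchy_seqs.
Proof.
split.
  apply/asboolP => e e0; exists 0%N => m n _ _.
  by rewrite (_ : 0 m - 0 n = 0 :> V) ?seminorm0// subrr.
move=> a u v /asboolP cu /asboolP cv; apply/asboolP => e e0.
have a0 : 0 < `|a| + 1 by rewrite ltr_wpDl.
have [|N1 H1] := cu (e / 2 / (`|a| + 1)); first by rewrite !divr_gt0.
have [|N2 H2] := cv (e / 2); first by rewrite divr_gt0.
exists (maxn N1 N2) => m n; rewrite !geq_max => /andP[m1 m2] /andP[n1 n2].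
have -> : (a *: u + v) m - (a *: u + v) n = a *: (u m - u n) + (v m - v n).
  by rewrite scalerBr addrACA opprD.
rewrite (le_lt_trans (seminormD _ _ _))// [ltRHS]splitr ler_ltD ?H2//.
rewrite seminormZ (@le_trans _ _ ((`|a| + 1) * p (u m - u n)))//.
  by rewrite ler_wpM2r ?seminorm_ge0// lerDl.
by rewrite mulrC -ler_pdivlMr// ltW// H1.
Qed.

HB.instance Definition _ :=
  GRing.isSubmodClosed.Build R (nat -> V) cauchy_seqs cauchy_seqs_submod.

Record cauchy_seq := CauchySeq {
  cauchy_val :> nat -> V; cauchy_valP : cauchy_val \in cauchy_seqs }.

HB.instance Definition _ := [isSub for cauchy_val].
HB.instance Definition _ := [Choice of cauchy_seq by <:].
HB.instance Definition _ := [SubChoice_isSubLmodule of cauchy_seq by <:].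

Definition null_seqs : {pred cauchy_seq} := fun u =>
  `[< (p (u n) @[n --> \oo] --> (0 : R)) >].

Lemma null_seqs_submod : submod_closed null_seqs.
Proof.
split.
  apply/asboolP; under eq_fun do rewrite [X in p X](_ : _ = 0)// seminorm0.
  exact: cvg_cst.
move=> a u v /asboolP nu /asboolP nv; apply/asboolP.
apply: (@squeeze_cvgr _ _ _ _ (cst 0) (fun n => `|a| * p (u n) + p (v n))).
- apply: nearW => n; rewrite seminorm_ge0/= -seminormZ.
  exact: seminormD.
- exact: cvg_cst.
- rewrite -[X in _ --> X]addr0 -[X in _ --> X + _](mulr0 `|a|).
  by apply: cvgD => //; apply: cvgMr.
Qed.

HB.instance Definition _ :=
  GRing.isSubmodClosed.Build R cauchy_seq null_seqs null_seqs_submod.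

Definition completion : Type := Quotient.quot null_seqs.
HB.instance Definition _ := GRing.Zmodule.on completion.
HB.instance Definition _ := EqQuotient.on completion.


Definition completion_pi (u : cauchy_seq) : completion :=
  (\pi_(Quotient.quot null_seqs) u)%qT.

Lemma completion_ind (P : completion -> Prop) :
  (forall u, P (completion_pi u)) -> forall x, P x.
Proof. by move=> H x; rewrite -[x]reprK; exact: H. Qed.

Lemma completion_piD u v :
  completion_pi (u + v) = completion_pi u + completion_pi v.
Proof. exact: Quotient.pi_add. Qed.

Lemma completion_eqP u v :
  completion_pi u = completion_pi v <-> p (u n - v n) @[n --> \oo] --> (0 : R).
Proof.
have E : (completion_pi u = completion_pi v) <-> (u - v) \in null_seqs.
  by rewrite Quotient.idealrBE; split=> [/eqP|/eqP].
split=> [/E/asboolP//|H]; exact/E/asboolP.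
Qed.

Definition completion_scale (a : R) (x : completion) : completion :=
  completion_pi (a *: (repr x : cauchy_seq)).

Lemma completion_scale_pi a u :
  completion_scale a (completion_pi u) = completion_pi (a *: u).
Proof.
apply/completion_eqP.
have /completion_eqP H : completion_pi (repr (completion_pi u)) = completion_pi u.
  exact: reprK.
rewrite -[X in _ --> X](mulr0 `|a|).
under eq_fun do rewrite /= -scalerBr seminormZ.
exact: cvgMr.
Qed.

Lemma completion_scaleA a b x :
  completion_scale a (completion_scale b x) = completion_scale (a * b) x.
Proof. by elim/completion_ind: x => u; rewrite !completion_scale_pi scalerA. Qed.

Lemma completion_scale1 : left_id 1 completion_scale.
Proof. by elim/completion_ind => u; rewrite completion_scale_pi scale1r. Qed.

Lemma completion_scaleDr : right_distributive completion_scale +%R.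
Proof.
move=> a; elim/completion_ind => u; elim/completion_ind => v.
by rewrite -completion_piD !completion_scale_pi -completion_piD scalerDr.
Qed.

Lemma completion_scaleDl x : {morph completion_scale^~ x : a b / a + b}.
Proof.
elim/completion_ind: x => u a b.
by rewrite !completion_scale_pi -completion_piD scalerDl.
Qed.

HB.instance Definition _ := GRing.Zmodule_isLmodule.Build R completion
  completion_scaleA completion_scale1 completion_scaleDr completion_scaleDl.

Definition completion_norm (x : completion) : R :=
  limn (fun n => p ((repr x : cauchy_seq) n)).

Lemma cauchy_seqP (u : cauchy_seq) e : 0 < e ->
  exists N, forall m n, (N <= m)%N -> (N <= n)%N -> p (u m - u n) < e.
Proof. by move=> e0; have /asboolP := cauchy_valP u; exact. Qed.

Lemma cauchy_seq_cvgn (u : cauchy_seq) : cvgn (p \o u).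
Proof.
apply: cauchy_cvg; apply/cauchy_exP => e e0.
have [N HN] := cauchy_seqP u e0.
exists (p (u N)), N => // n /= Nn; rewrite /ball/=.
exact: le_lt_trans (seminorm_lip _ _ _) (HN _ _ _ _).
Qed.

Lemma completion_norm_pi u : completion_norm (completion_pi u) = limn (p \o u).
Proof.
have /completion_eqP H : completion_pi (repr (completion_pi u)) = completion_pi u.
  exact: reprK.
set v := repr (completion_pi u) : cauchy_seq.
apply/eqP; rewrite -subr_eq0 -limB; try exact: cauchy_seq_cvgn.
apply/eqP/cvg_lim => //; apply/norm_cvg0P.
apply: squeeze_cvgr H; last exact: cvg_cst.
by apply: nearW => n /=; rewrite normr_ge0 seminorm_lip.
Qed.

Lemma completion_normD x y :
  completion_norm (x + y) <= completion_norm x + completion_norm y.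
Proof.
elim/completion_ind: x => u; elim/completion_ind: y => v.
rewrite -completion_piD !completion_norm_pi -limD; try exact: cauchy_seq_cvgn.
apply: ler_lim; first exact: cauchy_seq_cvgn.
  by apply: is_cvgD; exact: cauchy_seq_cvgn.
by apply: nearW => n; exact: seminormD.
Qed.

Lemma completion_normZ a x : completion_norm (a *: x) = `|a| * completion_norm x.
Proof.
elim/completion_ind: x => u.
rewrite [a *: _]completion_scale_pi !completion_norm_pi.
apply/cvg_lim => //.
rewrite (_ : _ \o _ = fun n => `|a| * p (u n)); last first.
  by apply/funext => n; rewrite /= seminormZ.
by apply: cvgMr; exact: cauchy_seq_cvgn.
Qed.

Lemma completion_norm_eq0 x : completion_norm x = 0 -> x = 0.
Proof.
elim/completion_ind: x => u; rewrite completion_norm_pi => u0.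
have -> : 0 = completion_pi 0.
  by apply: (addrI (completion_pi 0)); rewrite -completion_piD !addr0.
apply/completion_eqP; under eq_fun do rewrite subr0.
by rewrite -u0; exact: cauchy_seq_cvgn.
Qed.

HB.instance Definition _ := Lmodule_isNormed.Build R completion
  completion_normD completion_normZ completion_norm_eq0.

Lemma completion_normE (x : completion) :
  `|x| = limn (fun n => p ((repr x : cauchy_seq) n)).
Proof. by []. Qed.

Lemma cst_cauchy_seqs (v : V) : cst v \in cauchy_seqs.
Proof. by apply/asboolP => e e0; exists 0%N => m n _ _; rewrite subrr seminorm0. Qed.

Definition completion_inj (v : V) : completion :=
  completion_pi (CauchySeq (cst_cauchy_seqs v)).

Lemma completion_inj_is_linear : linear completion_inj.
Proof.
move=> a u v; rewrite [a *: completion_inj u]completion_scale_pi -completion_piD.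
by congr completion_pi; exact: val_inj.
Qed.

HB.instance Definition _ := GRing.isLinear.Build R V completion _ completion_inj
  completion_inj_is_linear.

Lemma completion_norm_inj v : `|completion_inj v| = p v.
Proof. by rewrite [LHS]completion_norm_pi /comp/= lim_cst. Qed.

Lemma completion_inj_cauchy (u : cauchy_seq) e : 0 < e ->
  exists N, forall n, (N <= n)%N -> `|completion_pi u - completion_inj (u n)| <= e.
Proof.
move=> e0; have [N HN] := cauchy_seqP u e0; exists N => n Nn.
have piB (w w' : cauchy_seq) :
    completion_pi w - completion_pi w' = completion_pi (w - w').
  by apply/eqP; rewrite subr_eq -completion_piD subrK.
rewrite piB [leLHS]completion_norm_pi.
apply: limr_le; first exact: cauchy_seq_cvgn.
by exists N => // m /= Nm; rewrite ltW// HN.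
Qed.

Lemma completion_dense (x : completion) e : 0 < e -> exists v, `|x - completion_inj v| < e.
Proof.
elim/completion_ind: x => u e0.
have [|N HN] := @completion_inj_cauchy u (e / 2); first by rewrite divr_gt0.
exists (u N); rewrite (le_lt_trans (HN N (leqnn N)))//.
by rewrite ltr_pdivrMr// ltr_pMr// ltr1n.
Qed.

Lemma completion_complete (F : set_system completion) :
  ProperFilter F -> cauchy F -> cvg F.
Proof.
move=> FF /cauchyP Fc.
have step n : exists v, F (ball (completion_inj v) (n.+1%:R^-1)).
  have [|z Fz] := Fc (n.+1%:R^-1 / 2); first by rewrite divr_gt0.
  have [|v zv] := @completion_dense z (n.+1%:R^-1 / 2); first by rewrite divr_gt0.
  exists v; apply: filterS Fz => y; rewrite -!ball_normE/= => zy.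
  rewrite -(subrK z (completion_inj v)) -addrA.
  by rewrite (le_lt_trans (ler_normD _ _))// [ltRHS]splitr ltrD// distrC.
have {step}[v Fv] := choice step.
have vB m n : p (v m - v n) < m.+1%:R^-1 + n.+1%:R^-1.
  have [y [/= ym yn]] := filter_ex (filterI (Fv m) (Fv n)).
  rewrite -completion_norm_inj raddfB/= -(subrK y (completion_inj (v m))) -addrA.
  move: ym yn; rewrite -!ball_normE/= => ym yn.
  by rewrite (le_lt_trans (ler_normD _ _))// ltrD// distrC.
have small (e : R) : 0 < e -> exists N, forall n, (N <= n)%N -> n.+1%:R^-1 < e.
  move=> e0; have [N _ HN] := near_infty_natSinv_lt (PosNum e0).
  by exists N => n Nn; exact: HN.
have cv : v \in cauchy_seqs.
  apply/asboolP => e e0; have [|N HN] := small (e / 2); first by rewrite divr_gt0.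
  exists N => m n Nm Nn; rewrite (lt_trans (vB m n))// [ltRHS]splitr.
  by rewrite ltrD// HN.
apply/cvg_ex; exists (completion_pi (CauchySeq cv)).
apply/cvgrPdist_lt => e e0.
have e20 : 0 < e / 2 by rewrite divr_gt0.
have [N1 H1] := small _ e20.
have [N2 H2] := @completion_inj_cauchy (CauchySeq cv) _ e20.
pose n := maxn N1 N2.
apply: filterS (Fv n) => y; rewrite -ball_normE/= => yn.
rewrite -(subrK (completion_inj (v n)) (completion_pi _)) -addrA [ltRHS]splitr.
rewrite (le_lt_trans (ler_normD _ _))// ler_ltD ?H2 ?leq_maxr//.
by rewrite (lt_trans yn)// H1// leq_maxl.
Qed.

HB.instance Definition _ := Uniform_isComplete.Build completion completion_complete.

End Completion.

(* The algebraic tensor product in Ryan's realisation: the linear span, inside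
   the space of all functionals on the bilinear forms X x Y -> R (algebraic, no
   boundedness required), of the evaluations A |-> A x y.  Sums suffice for the
   span because scalars are absorbed in the first factor. *)
Section Tensor.
Context (R : realType) (X Y : lmodType R).

Definition eval_at (x : X) (y : Y) : {bilinear X -> Y -> R^o} -> R^o :=
  fun A => A x y.

Definition tensors : {pred {bilinear X -> Y -> R^o} -> R^o} := fun u =>
  `[< exists s : seq (X * Y), u = \sum_(z <- s) eval_at z.1 z.2 >].

Lemma tensors_submod : submod_closed tensors.
Proof.
split; first by apply/asboolP; exists [::]; rewrite big_nil.
move=> a u v /asboolP[s ->] /asboolP[t ->]; apply/asboolP.
exists ([seq (a *: z.1, z.2) | z <- s] ++ t).
rewrite big_cat big_map/= scaler_sumr; congr (_ + _).
by apply: eq_bigr => z _; apply/funext => A; rewrite /eval_at/= linearZl_LR.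
Qed.

HB.instance Definition _ :=
  GRing.isSubmodClosed.Build R ({bilinear X -> Y -> R^o} -> R^o) tensors tensors_submod.

Record tensor := Tensor {
  tensor_val :> {bilinear X -> Y -> R^o} -> R^o; tensor_valP : tensor_val \in tensors }.

HB.instance Definition _ := [isSub for tensor_val].
HB.instance Definition _ := [Choice of tensor by <:].
HB.instance Definition _ := [SubChoice_isSubLmodule of tensor by <:].

Lemma eval_at_tensors x y : eval_at x y \in tensors.
Proof. by apply/asboolP; exists [:: (x, y)]; rewrite big_seq1. Qed.

Definition elem_tensor x y : tensor := Tensor (eval_at_tensors x y).

Lemma elem_tensorZl a x y : elem_tensor (a *: x) y = a *: elem_tensor x y.
Proof.
by apply/val_inj/funext => A; rewrite /= /eval_at linearZl_LR.
Qed.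

Lemma tensor_sum (u : tensor) :
  exists s : seq (X * Y), u = \sum_(z <- s) elem_tensor z.1 z.2.
Proof.
have /asboolP[s us] := tensor_valP u; exists s; apply: val_inj.
by rewrite [RHS]raddf_sum; exact: us.
Qed.

End Tensor.

Section ProjectiveTensor.
Context (R : realType) (X Y : normedModType R).

Definition proj_costs (u : tensor X Y) : set R :=
  [set \sum_(z <- s) `|z.1| * `|z.2| |
    s in [set s : seq (X * Y) | u = \sum_(z <- s) elem_tensor z.1 z.2]].

Definition proj_norm (u : tensor X Y) : R := inf (proj_costs u).

Lemma proj_costs_ge0 u c : proj_costs u c -> 0 <= c.
Proof. by case=> s _ <-; apply: sumr_ge0 => z _; rewrite mulr_ge0. Qed.

Lemma proj_costs_has_inf u : has_inf (proj_costs u).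
Proof.
split; last by exists 0 => c /proj_costs_ge0.
by have [s us] := tensor_sum u; eexists; exists s.
Qed.

Lemma proj_normD u v : proj_norm (u + v) <= proj_norm u + proj_norm v.
Proof.
apply/ler_addgt0Pr => e e0; have e20 : 0 < e / 2 by rewrite divr_gt0.
have [_ [s us <-] su] := inf_adherent e20 (proj_costs_has_inf u).
have [_ [t vt <-] tv] := inf_adherent e20 (proj_costs_has_inf v).
rewrite [e]splitr addrACA (le_trans _ (lerD (ltW su) (ltW tv)))//.
apply: ge_inf; first by case: (proj_costs_has_inf (u + v)).
by exists (s ++ t); rewrite /= big_cat//= us vt.
Qed.

Let proj_normZ_le a u : proj_norm (a *: u) <= `|a| * proj_norm u.
Proof.
apply/ler_addgt0Pr => e e0.
have e10 : 0 < e / (`|a| + 1) by rewrite divr_gt0// ltr_wpDl.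
have [_ [s us <-] su] := inf_adherent e10 (proj_costs_has_inf u).
apply: (@le_trans _ _ (`|a| * (proj_norm u + e / (`|a| + 1)))); last first.
  rewrite mulrDr lerD2l mulrCA ler_piMr ?(ltW e0)//.
  by rewrite ler_pdivrMr ?mul1r ?lerDl// ltr_wpDl.
rewrite (le_trans _ (ler_wpM2l (normr_ge0 a) (ltW su)))//.
apply: ge_inf; first by case: (proj_costs_has_inf (a *: u)).
exists [seq (a *: z.1, z.2) | z <- s].
  rewrite /= us scaler_sumr big_map; apply: eq_bigr => z _.
  by rewrite elem_tensorZl.
rewrite big_map mulr_sumr; apply: eq_bigr => z _.
by rewrite /= normrZ mulrA.
Qed.

Lemma proj_normZ a u : proj_norm (a *: u) = `|a| * proj_norm u.
Proof.
have [->|a0] := eqVneq a 0.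
  apply/eqP; rewrite eq_le proj_normZ_le normr0 mul0r.
  by apply: lb_le_inf; [case: (proj_costs_has_inf (0 *: u))|move=> c /proj_costs_ge0].
apply/eqP; rewrite eq_le proj_normZ_le/=.
have := proj_normZ_le a^-1 (a *: u); rewrite scalerA mulVf// scale1r normfV.
by rewrite ler_pdivlMl ?normr_gt0.
Qed.

(* proj_norm is in fact a norm, but the completion only needs a seminorm. *)
Definition proj_seminorm := Seminorm proj_normD proj_normZ.

Definition projective_tensor : completeNormedModType R := completion proj_seminorm.

End ProjectiveTensor.

(* The normed-space structure on LspaceType, the a.e.-equivalence classes of
   measurable functions of finite p-norm, for which only the carrier is
   available in the library. *)
Section LpSpace.
Context d (T : measurableType d) (R : realType) (mu : {measure set T -> \bar R}).
Context (p : \bar R) (p1 : (1 <= p)%E).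

Local Notation Lp := (LspaceType mu p1).
Local Notation Lf := (LfunType mu p1).

Lemma ae_eq_Lnorm (f g : {mfun T >-> measurableTypeR R}) : f = g %[ae mu] ->
  Lnorm mu p (EFin \o f) = Lnorm mu p (EFin \o g).
Proof.
have mP (h : {mfun T >-> measurableTypeR R}) (r : R) :
    measurable_fun [set: T] ((fun x => (`|(EFin \o h) x| `^ r)%E) : T -> \bar R).
  apply: (@measurableT_comp _ _ _ _ _ _ (fun x : \bar R => (x `^ r)%E)) => //=.
    exact: (measurableT_comp (measurable_poweR _)).
  apply: (@measurableT_comp _ _ _ _ _ _ (@abse R) _ (EFin \o h)) => //.
  by apply/measurable_EFinP; exact: (@measurable_funPT _ _ _ _ h).
move=> fg; rewrite unlock /Lnorm; case: p p1 => [r _| _|//].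
  congr (_ `^ _)%E; apply: ae_eq_integral => //.
  - by apply: filterS fg => x /= fgx _; rewrite fgx.
case: ifPn => // _; apply: eq_ess_sup.
by apply: filterS fg => x /= fgx; rewrite fgx.
Qed.

Local Notation quo := {mfun_ mu, T >-> measurableTypeR R}.

Lemma Lp_repr_subproof (f : Lp) : (repr (f : quo) : T -> R) \in Lfun mu p.
Proof.
rewrite inE; apply/andP; split; rewrite inE/=.
  exact: (@measurable_funPT _ _ _ _ (repr (f : quo))).
exact: (@Lebesgue_finite _ _ _ _ _ _ f).
Qed.

Definition Lp_repr (f : Lp) : Lf := Lfun_Sub p1 (Lp_repr_subproof f).

Definition Lp_mfun (f : Lf) : {mfun T >-> measurableTypeR R} :=
  MeasurableFun.Pack (MeasurableFun.Class
    (isMeasurableFun.Build d _ T (measurableTypeR R) f (@measurable_funPT _ _ _ _ f))).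

Lemma Lp_repr_pi (f : Lf) :
  (repr (\pi_quo (Lp_mfun f))%qT : T -> R) = f %[ae mu].
Proof.
have /eqP := reprK (\pi_quo (Lp_mfun f))%qT.
by rewrite eqmodE => /asboolP.
Qed.

Lemma Lp_class_subproof (f : Lf) :
  finite_norm mu p (\pi_quo (Lp_mfun f) : quo)%qT.
Proof.
rewrite /finite_norm (@ae_eq_Lnorm _ (Lp_mfun f)); first exact: Lfunction_finite.
exact: Lp_repr_pi.
Qed.

Definition Lp_class (f : Lf) : Lp :=
  LebesgueSpace.Pack (LebesgueSpace.Class
    (isFinLebesgue.phant_Build p1 (Lp_class_subproof f))).

Lemma Lp_quo_inj (f g : Lp) : (f : quo) = (g : quo) -> f = g.
Proof.
case: f => f [[pf]]; case: g => g [[pg]] /= fg; subst g.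
by rewrite (Prop_irrelevance pf pg).
Qed.

Lemma Lp_class_eq (f g : Lf) : Lp_class f = Lp_class g <-> f = g %[ae mu].
Proof.
split=> [/(congr1 (fun h : Lp => (h : quo)))/eqP|fg].
  by rewrite /= eqmodE => /asboolP.
by apply: Lp_quo_inj; apply/eqP; rewrite /= eqmodE; exact/asboolP.
Qed.

Lemma Lp_reprK (f : Lp) : Lp_class (Lp_repr f) = f.
Proof.
apply: Lp_quo_inj => /=; rewrite -[RHS]reprK; apply/eqP; rewrite eqmodE.
by apply/asboolP; exact: aeW.
Qed.

Lemma Lp_repr_class (f : Lf) : Lp_repr (Lp_class f) = f %[ae mu].
Proof. exact: Lp_repr_pi. Qed.

Lemma Lp_ind (P : Lp -> Prop) : (forall f, P (Lp_class f)) -> forall f, P f.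
Proof. by move=> H f; rewrite -[f]Lp_reprK; exact: H. Qed.

HB.instance Definition _ := gen_eqMixin Lp.
HB.instance Definition _ := gen_choiceMixin Lp.

Definition Lp_add (f g : Lp) : Lp := Lp_class (Lp_repr f + Lp_repr g).
Definition Lp_opp (f : Lp) : Lp := Lp_class (- Lp_repr f).
Definition Lp_scale (a : R) (f : Lp) : Lp := Lp_class (a *: Lp_repr f).
Definition Lp_norm (f : Lp) : R := fine (Lnorm mu p (EFin \o Lp_repr f)).

Lemma Lp_add_class f g : Lp_add (Lp_class f) (Lp_class g) = Lp_class (f + g).
Proof.
apply/Lp_class_eq.
apply: filterS2 (Lp_repr_class f) (Lp_repr_class g) => x fx gx _.
exact: (congr2 +%R (fx I) (gx I)).
Qed.

Lemma Lp_opp_class f : Lp_opp (Lp_class f) = Lp_class (- f).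
Proof.
apply/Lp_class_eq; apply: filterS (Lp_repr_class f) => x fx _.
exact: (congr1 -%R (fx I)).
Qed.

Lemma Lp_scale_class a f : Lp_scale a (Lp_class f) = Lp_class (a *: f).
Proof.
apply/Lp_class_eq; apply: filterS (Lp_repr_class f) => x fx _.
exact: (congr1 ( *%R a) (fx I)).
Qed.

Lemma Lp_norm_class f : Lp_norm (Lp_class f) = fine (Lnorm mu p (EFin \o f)).
Proof.
congr fine; apply: (@ae_eq_Lnorm (Lp_mfun _) (Lp_mfun f)).
exact: Lp_repr_class.
Qed.

Lemma Lp_addA : associative Lp_add.
Proof.
elim/Lp_ind => f; elim/Lp_ind => g; elim/Lp_ind => h.
by rewrite !Lp_add_class addrA.
Qed.

Lemma Lp_addC : commutative Lp_add.
Proof. by elim/Lp_ind => f; elim/Lp_ind => g; rewrite !Lp_add_class addrC. Qed.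

Lemma Lp_add0 : left_id (Lp_class 0) Lp_add.
Proof. by elim/Lp_ind => f; rewrite Lp_add_class add0r. Qed.

Lemma Lp_addN : left_inverse (Lp_class 0) Lp_opp Lp_add.
Proof. by elim/Lp_ind => f; rewrite Lp_opp_class Lp_add_class addNr. Qed.

HB.instance Definition _ := GRing.isZmodule.Build Lp Lp_addA Lp_addC Lp_add0 Lp_addN.

Lemma Lp_scaleA a b f : Lp_scale a (Lp_scale b f) = Lp_scale (a * b) f.
Proof. by elim/Lp_ind: f => f; rewrite !Lp_scale_class scalerA. Qed.

Lemma Lp_scale1 : left_id 1 Lp_scale.
Proof. by elim/Lp_ind => f; rewrite Lp_scale_class scale1r. Qed.

Lemma Lp_scaleDr : right_distributive Lp_scale +%R.
Proof.
move=> a; elim/Lp_ind => f; elim/Lp_ind => g.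
by rewrite [_ + _]Lp_add_class !Lp_scale_class [RHS]Lp_add_class scalerDr.
Qed.

Lemma Lp_scaleDl f : {morph Lp_scale^~ f : a b / a + b}.
Proof.
elim/Lp_ind: f => f a b.
by rewrite !Lp_scale_class [RHS]Lp_add_class scalerDl.
Qed.

HB.instance Definition _ := GRing.Zmodule_isLmodule.Build R Lp
  Lp_scaleA Lp_scale1 Lp_scaleDr Lp_scaleDl.

Lemma Lp_normD (f g : Lp) : Lp_norm (f + g) <= Lp_norm f + Lp_norm g.
Proof.
elim/Lp_ind: f => f; elim/Lp_ind: g => g.
by rewrite [_ + _]Lp_add_class !Lp_norm_class; exact: ler_LnormD.
Qed.

Lemma Lp_normZ a (f : Lp) : Lp_norm (a *: f) = `|a| * Lp_norm f.
Proof.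
elim/Lp_ind: f => f; rewrite [a *: _]Lp_scale_class !Lp_norm_class.
by apply: EFin_inj; rewrite EFinM !finite_norm_fine; exact: LnormZ.
Qed.

Lemma Lp_norm_eq0 (f : Lp) : Lp_norm f = 0 -> f = 0.
Proof.
elim/Lp_ind: f => f; rewrite Lp_norm_class => /fine_Lnormr_eq0 f0.
exact/Lp_class_eq.
Qed.

HB.instance Definition _ := Lmodule_isNormed.Build R Lp Lp_normD Lp_normZ Lp_norm_eq0.

End LpSpace.

(* Lebesgue measure restricted to [0, 1], as a measure on R: functions are
   defined on all of R but identified when they agree a.e. on [0, 1]. *)
Definition lebesgue01 (R : realType) : {measure set measurableTypeR R -> \bar R} :=
  mrestr (@lebesgue_measure R) (measurable_itv `[(0:R), 1]).

Definition Lp01 (R : realType) (p : R) (p1 : 1 <= p) : normedModType R :=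
  LspaceType (lebesgue01 R) (p1 : (1 <= p%:E)%E).

Definition dual (R : realType) (Z : normedModType R) :=
  {f : {linear Z -> R^o} | continuous f}.

Definition weak (R : realType) (Z : normedModType R) : topologicalType :=
  sup_topology (fun f : dual Z =>
    Topological.class (initial_topology (sval f : Z -> R^o))).

Definition weakly_compact (R : realType) (Z : normedModType R) (K : set Z) : Prop :=
  @compact (weak Z) K.

Definition unit_ball (R : realType) (Z : normedModType R) : set Z :=
  [set z | `|z| <= 1].

Definition SWCG (R : realType) (Z : completeNormedModType R) : Prop :=
  exists2 G : set Z, weakly_compact G &
    forall K : set Z, weakly_compact K -> forall e : R, 0 < e ->
      exists n : nat,
        K `<=` [set n%:R *: g + e *: b | g in G & b in @unit_ball R Z].

(* Main.v *)
Require Import Defs.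
From HB Require Import structures.
From mathcomp Require Import all_boot all_order all_algebra.
From mathcomp Require Import all_classical all_reals all_analysis.
From mathcomp Require Import measurable_realfun ring lra zify.

Set Implicit Arguments.
Unset Strict Implicit.
Unset Printing Implicit Defensive.

Import Order.TTheory GRing.Theory Num.Theory.
Import numFieldNormedType.Exports.

Local Open Scope classical_set_scope.
Local Open Scope ring_scope.

(** The two factors enter through two properties, which hold for L_p when
    1 < p <= 2.  The squared norm is uniformly convex of power type two: the
    midpoint inequality |(v + w)/2|^2 + c |(v - w)/2|^2 <= (|v|^2 + |w|^2)/2
    holds with some c > 0 ([Lp_two_convex]).  And the averages P_n over the
    dyadic intervals of length 2^-n are nested contractions of finite rank that
    converge strongly to the identity ([dyadic_approximation]).  Any two normed
    spaces X, Y with these properties have an SWCG projective tensor product Z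
    ([SWCG_projective_tensor]).

    Write S_n for the operator (I - P_n) (x) (I - Q_n) on Z and split
    z = (z - S_n z) + S_n z.

    The first summands form a small set.  The operator I - S_n equals
    P_n (x) I + (I - P_n) (x) Q_n, so its values are limits of sums of tensors
    e_i (x) y_i and x_j (x) f_j with finitely many fixed vectors e_i, f_j.
    They lie in the closed image of a product Y^d x X^d', on which the sum of
    the squared norms is again uniformly convex, and the closed image of a ball
    of such a space is weakly compact ([weakly_compact_ball_image], the
    Milman-Pettis argument).  Scaled to have radius at most 1/(n + 1), these
    compact images G_n together with 0 make up one weakly compact set G, and
    the multiples of G absorb (I - S_n) M for every n and every bounded set M.

    The second summands are uniformly small on a weakly compact set K: the
    supremum of |S_n z| over K tends to 0 ([weakly_compact_tail]).  Convexity
    gives an upper bound C |x|^2 for the sum of |P_m x - P_n x|^2 over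
    successive blocks (n, m], and likewise for Y.  By the Cauchy-Schwarz
    inequality the diagonal blocks D = (P_m - P_n) (x) (Q_m - Q_n) satisfy
    sum |D z| <= C |z| ([sum_blocks_le]): they map Z into an l_1-sum.  If the
    tails were not uniformly small, a gliding hump as in Schur's theorem on l_1
    would produce a functional contradicting the weak compactness of K.

    So K is contained in k G + e B as soon as n is large enough for the tails
    and k for the absorption. *)

(** * Functionals and the weak topology *)

Section Dual.
Context (R : realType) (Z : normedModType R).

Lemma dual_of_bounded (g : Z -> R) (M : R) :
  (forall a x y, g (a *: x + y) = a * g x + g y) ->
  (forall z, `|g z| <= M * `|z|) ->
  exists f : dual Z, forall z, sval f z = g z.
Proof.
move=> lin bd.
pose L := GRing.isLinear.Build R Z R^o _ (g : Z -> R^o) lin.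
pose G : {linear Z -> R^o} := HB.pack (g : Z -> R^o) L.
suff cG : continuous G by exists (exist _ G cG).
apply/linear_bounded_continuous/linear_boundedP.
near=> r => x; rewrite (le_trans (bd x))// ler_wpM2r//.
Unshelve. end_near. Qed.

Lemma dual_bounded (f : dual Z) : exists2 M : R, 0 < M &
  forall z, `|sval f z : R| <= M * `|z|.
Proof.
case: f => f cf /=.
have /linear_boundedP/pinfty_ex_gt0[M M0 HM] := continuous_linear_bounded 0 (cf 0).
by exists M.
Qed.

Lemma cvg_weakP (F : set_system Z) (FF : Filter F) (z : Z) :
  F --> (z : weak Z) <-> forall f : dual Z, sval f x @[x --> F] --> sval f z.
Proof.
rewrite cvg_sup; split=> H f.
  apply: (cvg_trans _ (@initial_continuous Z R^o (sval f) z)).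
  by apply: cvg_app; exact: H.
move=> A [B [[C oC CB] Bz BA]]; rewrite nbhs_filterE.
apply: filterS BA _; rewrite -CB; apply: H.
by apply: open_nbhs_nbhs; split=> //; move: Bz; rewrite -CB.
Qed.

Lemma weakly_compactP (K : set Z) : weakly_compact K <->
  forall F : set_system Z, UltraFilter F -> F K ->
    exists2 z, K z & forall f : dual Z, sval f x @[x --> F] --> sval f z.
Proof.
rewrite /weakly_compact compact_ultra; split=> H F UF FK.
  by have [z [Kz /cvg_weakP Hz]] := H F UF FK; exists z.
by have [z Kz Hz] := H F UF FK; exists z; split=> //; apply/cvg_weakP.
Qed.

(** Weak compactness enters the gliding hump arguments in this form: infinitely
    many terms of a sequence are close to one point as seen by any finite
    number of functionals. *)
Lemma weak_cluster (K : set Z) (u : nat -> Z) : weakly_compact K ->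
  (forall n, K (u n)) -> exists2 w, K w & forall (fs : seq (dual Z)) (e : R) N,
    0 < e -> exists2 n, (N <= n)%N &
      forall f, List.In f fs -> `|sval f (u n) - sval f w| < e.
Proof.
move=> Kc Ku.
have uK : (u @ \oo) K by apply: (@filterE _ \oo).
have [w [Kw Hw]] := Kc (u @ \oo) _ uK.
exists w => // fs e N e0.
pose A : set (weak Z) :=
  [set z | forall f, List.In f fs -> `|sval f z - sval f w| < e].
have nA : nbhs (w : weak Z) A.
  have wc : forall f : dual Z, \forall z \near (w : weak Z), `|sval f z - sval f w| < e.
    move=> f; have [+ _] := @cvg_weakP (nbhs (w : weak Z)) _ w.
    move=> /(_ (@cvg_id _ _))/(_ f)/cvgrPdist_lt/(_ _ e0).
    by apply: filterS => z; rewrite distrC.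
  rewrite /A; elim: fs {A} => [|f fs IH]; first by apply: filterS filterT => z _ f [].
  apply: filterS2 IH (wc f) => z zfs zf g [<-//|]; exact: zfs.
have := Hw (u @` [set n | (N <= n)%N]) _ _ nA.
case; first by exists N => // n /= Nn; exists n.
by move=> _ [[n /= Nn <-] An]; exists n.
Qed.

End Dual.

(** * The Hahn-Banach theorem *)

Section HahnBanach.
Context (R : realType) (V : lmodType R) (p : seminorm V).

(** A dominated linear functional on a subspace, encoded by its graph: extension
    is then inclusion, and chains have their unions as upper bounds. *)
Definition dominated_graph (G : set (V * R)) :=
  (forall a u v, G u -> G v -> G (a *: u.1 + v.1, a * u.2 + v.2)) /\
  (forall u, G u -> u.2 <= p u.1).

Lemma dominated_graph0 G u : dominated_graph G -> G u -> G (0, 0).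
Proof. by move=> [lin _] Gu; have := lin (-1) _ _ Gu Gu; rewrite scaleN1r mulN1r !addNr. Qed.

Lemma dominated_graphZ G a u : dominated_graph G -> G u -> G (a *: u.1, a * u.2).
Proof.
move=> dG Gu; have := dG.1 a _ _ Gu (dominated_graph0 dG Gu).
by rewrite !addr0.
Qed.

Lemma dominated_graph_fun G x r s :
  dominated_graph G -> G (x, r) -> G (x, s) -> r = s.
Proof.
move=> [lin dom] Gr Gs.
have := dom _ (lin (-1) _ _ Gr Gs); have := dom _ (lin (-1) _ _ Gs Gr).
rewrite /= scaleN1r addNr seminorm0 !mulN1r => h1 h2.
by apply/eqP; rewrite eq_le; apply/andP; split; lra.
Qed.

(** The admissible values at [v] are those between the two sides of [LU]; the
    supremum of the lower bounds is one of them. *)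
Lemma dominated_graph_extend G v : dominated_graph G -> G !=set0 ->
  exists2 H, dominated_graph H & G `<=` H /\ exists r, H (v, r).
Proof.
move=> dG [u0 Gu0].
pose L := [set u.2 - p (u.1 - v) | u in G].
have LU u u' : G u -> G u' -> u.2 - p (u.1 - v) <= p (u'.1 + v) - u'.2.
  move=> Gu Gu'; have := dG.2 _ (dG.1 1 _ _ Gu Gu').
  rewrite /= scale1r mul1r => h.
  have := seminormD p (u.1 - v) (u'.1 + v).
  by rewrite addrACA addNr addr0; lra.
have Lsup : has_sup L.
  split; first by exists (u0.2 - p (u0.1 - v)), u0.
  by exists (p (u0.1 + v) - u0.2) => _ [u Gu <-]; exact: LU.
pose r := sup L.
have rl u : G u -> u.2 - r <= p (u.1 - v).
  move=> Gu; rewrite lerBlDr addrC -lerBlDr; apply: sup_upper_bound => //.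
  by exists u.
have ru u : G u -> u.2 + r <= p (u.1 + v).
  move=> Gu; rewrite addrC -lerBrDr; apply: ge_sup; first by case: Lsup.
  by move=> _ [u' Gu' <-]; exact: LU.
exists [set (u.1 + a *: v, u.2 + a * r) | u in G & a in [set: R]].
  split.
    move=> a _ _ [u Gu [b _ <-]] [u' Gu' [b' _ <-]] /=.
    exists (a *: u.1 + u'.1, a * u.2 + u'.2); first exact: dG.1.
    exists (a * b + b') => //=; congr (_, _).
      by rewrite scalerDl scalerDr -scalerA addrACA.
    by ring.
  move=> _ [u Gu [a _ <-]] /=.
  have [a0|a0|->] := ltgtP a 0; last first.
  - by rewrite scale0r mul0r !addr0 dG.2.
  - have := ru _ (dominated_graphZ a^-1 dG Gu).
    rewrite -(ler_pM2l a0) /= -[X in _ <= X * _](gtr0_norm a0) -seminormZ.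
    rewrite scalerDr scalerA mulrDr mulrA divff ?gt_eqF// mul1r scale1r.
    by [].
  have b0 : 0 < - a by rewrite oppr_gt0.
  have := rl _ (dominated_graphZ (- a)^-1 dG Gu).
  rewrite -(ler_pM2l b0) /= -[X in _ <= X * _](gtr0_norm b0) -seminormZ.
  rewrite scalerBr scalerA mulrBr mulrA divff ?gt_eqF// mul1r scale1r.
  by rewrite scaleNr opprK mulNr opprK.
split; first by move=> u Gu; exists u => //; exists 0 => //; rewrite scale0r mul0r !addr0;
  case: u {Gu}.
exists r; exists (0, 0); first exact: dominated_graph0 Gu0.
by exists 1 => //=; rewrite scale1r mul1r !add0r.
Qed.

Lemma hahn_banach (z : V) : exists f : V -> R,
  [/\ forall a x y, f (a *: x + y) = a * f x + f y,
      forall x, `|f x| <= p x & f z = p z].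
Proof.
(* The empty graph is admitted, being the union of the empty chain; a maximal
   graph is nonempty all the same, since the line through [z] carries one. *)
pose P G := dominated_graph G /\ (G !=set0 -> G (z, p z)).
have [|A [[dA Az] maxA]] := @Zorn_bigcup _ P.
  move=> F FP tot; split; first split.
  - move=> a u v [X FX Xu] [Y FY Yv].
    have [XY|YX] := tot _ _ FX FY.
      by exists Y => //; apply: (FP _ FY).1.1 => //; exact: XY.
    by exists X => //; apply: (FP _ FX).1.1 => //; exact: YX.
  - by move=> u [X FX Xu]; exact: (FP _ FX).1.2.
  - by move=> [u [X FX Xu]]; exists X => //; apply: (FP _ FX).2; exists u.
have A0 : A !=set0.
  apply: contrapT => nA.
  apply: (maxA [set (a *: z, a * p z) | a in [set: R]]).
    split; first by move=> u Au; case: nA; exists u.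
    by move=> /(_ (0, 0)) h; apply: nA; exists (0, 0); apply: h; exists 0; rewrite ?scale0r ?mul0r.
  split; first split.
  - move=> a _ _ [b _ <-] [b' _ <-] /=; exists (a * b + b') => //.
    by rewrite scalerDl mulrDl scalerA mulrA.
  - by move=> _ [a _ <-] /=; rewrite seminormZ ler_wpM2r ?seminorm_ge0// ler_norm.
  - by move=> _; exists 1; rewrite ?scale1r ?mul1r.
have tot v : exists r, A (v, r).
  have [H dH [AH [r Hr]]] := dominated_graph_extend v dA A0.
  exists r; apply: contrapT => nAr; apply: (maxA H).
    by split=> // /(_ _ Hr).
  by split=> // _; exact/AH/Az.
have [f Hf] := choice tot.
have fle x : f x <= p x by exact: (dA.2 _ (Hf x)).
have flin a x y : f (a *: x + y) = a * f x + f y.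
  apply: (dominated_graph_fun dA (Hf _)).
  exact: (dA.1 a _ _ (Hf x) (Hf y)).
exists f; split=> //; last exact: (dominated_graph_fun dA (Hf _) (Az A0)).
move=> x; rewrite ler_norml fle andbT lerNl -seminormN (le_trans _ (fle _))//.
have f0 : f 0 = 0 by have := flin (-1) 0 0; rewrite scaler0 addr0 mulN1r addNr.
by have := flin (-1) x 0; rewrite addr0 scaleN1r f0 addr0 mulN1r => ->.
Qed.

End HahnBanach.

Section NormingFunctional.
Context (R : realType) (Z : normedModType R).

Definition norm_seminorm : seminorm Z :=
  @Seminorm R Z (fun z => `|z|) (@ler_normD R Z) (@normrZ R Z).

Lemma norming_functional (z : Z) : exists f : dual Z,
  (forall x, `|sval f x : R| <= `|x|) /\ sval f z = `|z|.
Proof.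
have [g [lin bd gz]] := hahn_banach norm_seminorm z.
have [|f fg] := @dual_of_bounded R Z g 1 lin; first by move=> x; rewrite mul1r.
by exists f; split=> [x|]; rewrite fg.
Qed.

End NormingFunctional.

(** * Weak compactness from uniform convexity *)

(** For the square of a norm this is uniform convexity of power type two.  It is
    stated for a general [q] because it is also needed for sums of squared
    norms on products. *)
Definition two_convex (R : realType) (V : lmodType R) (c : R) (q : V -> R) :=
  forall v w, q (2^-1 *: (v + w)) + c * q (2^-1 *: (v - w)) <= (q v + q w) / 2.

Lemma two_convex_le (R : realType) (V : lmodType R) (c d : R) (q : V -> R) :
  (forall v, 0 <= q v) -> c <= d -> two_convex d q -> two_convex c q.
Proof.
move=> q0 cd h v w; rewrite (le_trans _ (h v w))// lerD2l.
by rewrite ler_wpM2r.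
Qed.

Section ConvexIntersection.
Context (R : realType) (Z : completeNormedModType R) (W : lmodType R).
Variables (Q : W -> R) (T : {linear W -> Z}) (c : R).
Hypothesis c_gt0 : 0 < c.
Hypothesis Q_ge0 : forall w, 0 <= Q w.
Hypothesis Q_convex : two_convex c Q.
Hypothesis T_le : forall w, `|T w| ^+ 2 <= Q w.

Definition midconvex (A : set Z) :=
  forall x y, A x -> A y -> A (2^-1 *: (x + y)).

Definition norm_closed (A : set Z) :=
  forall z, (forall e : R, 0 < e -> exists2 a, A a & `|z - a| < e) -> A z.

(** Members of a family of sets are not assumed to meet the range of [T]; they
    are seen from [W] through the points that [T] sends close to them. *)
Definition near_preimage (A : set Z) (e : R) : set W :=
  [set w | exists2 z, A z & `|z - T w| < e].

(** The norm closure of the image of the ball where [Q] is at most 1. *)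
Definition ball_image : set Z :=
  [set z | forall e : R, 0 < e -> exists2 w, Q w <= 1 & `|z - T w| < e].

Lemma midconvex_near_preimage A e v w : midconvex A ->
  near_preimage A e v -> near_preimage A e w -> near_preimage A e (2^-1 *: (v + w)).
Proof.
move=> cA [x Ax xv] [y Ay yw]; exists (2^-1 *: (x + y)); first exact: cA.
rewrite [T (_ *: _)]linearZ_LR [T (_ + _)]linearD -scalerBr opprD addrACA.
rewrite normrZ ger0_norm ?invr_ge0//.
have := ler_normD (x - T v) (y - T w); lra.
Qed.

(** A completeness argument in the role of reflexivity.  Let [d] be the supremum,
    over all near preimages of members, of the infimum of [Q].  Once the near
    preimage is so small that this infimum is almost [d], two of its points at
    which [Q] is almost [d] have a midpoint at which [Q] cannot drop much below
    [d], so the convexity of [Q] makes their images close.  These images thus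
    form a Cauchy filter, whose limit belongs to every member. *)
Lemma convex_family_inter (C : set (set Z)) : C !=set0 ->
  (forall A B, C A -> C B -> C (A `&` B)) ->
  (forall A, C A -> midconvex A /\ norm_closed A) ->
  (forall A e, C A -> 0 < e -> exists2 w, near_preimage A e w & Q w <= 1) ->
  exists z, forall A, C A -> A z.
Proof.
move=> [A0 CA0] CI Ccc Cne.
pose E := [set m | exists A e,
  [/\ C A, 0 < e & forall w, near_preimage A e w -> m <= Q w]].
have Esup : has_sup E.
  split; first by exists 0, A0, 1.
  exists 1 => m [A [e [CA e0 H]]]; have [w /H mw w1] := Cne A e CA e0.
  exact: le_trans w1.
pose d := sup E.
have low A e r : C A -> 0 < e -> 0 < r ->
    exists2 w, near_preimage A e w & Q w < d + r.
  move=> CA e0 r0; apply: contrapT => H.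
  have : d + r <= d.
    apply: sup_upper_bound => //; exists A, e; split => // w Aw.
    by rewrite leNgt; apply/negP => wr; apply: H; exists w.
  by rewrite gerDl leNgt r0.
have high r : 0 < r -> exists A e,
    [/\ C A, 0 < e & forall w, near_preimage A e w -> d - r < Q w].
  move=> r0; have [m [A [e [CA e0 H]]] dm] := sup_adherent r0 Esup.
  by exists A, e; split=> // w /H; exact: lt_le_trans.
pose D := [set i : set Z * R * R | [/\ C i.1.1, 0 < i.1.2 & 0 < i.2]].
pose B := fun i : set Z * R * R =>
  T @` [set w | near_preimage i.1.1 i.1.2 w /\ Q w < d + i.2].
have FF : ProperFilter (filter_from D B).
  apply: filter_from_proper; last first.
    move=> [[A e] r] [/= CA e0 r0]; have [w Aw wr] := low _ _ _ CA e0 r0.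
    by exists (T w), w.
  apply: filter_from_filter; first by exists (A0, 1, 1).
  move=> [[A e] r] [[A' e'] r'] [/= CA e0 r0] [/= CA' e0' r0'].
  exists (A `&` A', Num.min e e', Num.min r r').
    by split=> /=; rewrite ?lt_min ?e0 ?r0//; exact: CI.
  move=> _ [w [[z [Az A'z] zw] wr] <-] /=; move: zw wr.
  rewrite /= lt_min => /andP[ze ze'].
  rewrite addr_minr lt_min => /andP[wr wr'].
  by split; exists w => //; split=> //; exists z.
have Fc : cauchy (filter_from D B).
  apply/cauchy_exP => e e0.
  pose r := c * e ^+ 2 / 16.
  have r0 : 0 < r by rewrite divr_gt0// mulr_gt0// exprn_gt0.
  have [A [e' [CA e'0 H]]] := high r r0.
  have [w Aw wr] := low _ _ _ CA e'0 r0.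
  exists (T w), (A, e', r) => // _ [v [/= Av vr] <-].
  rewrite -ball_normE /ball_ /= -linearB.
  have := H _ (midconvex_near_preimage (Ccc _ CA).1 Aw Av).
  have := Q_convex w v; have := T_le (2^-1 *: (w - v)).
  rewrite [T (_ *: _)]linearZ_LR normrZ ger0_norm ?invr_ge0// => h1 h2 h3.
  have h4 : c * (2^-1 * `|T (w - v)|) ^+ 2 < 2 * r.
    have : c * (2^-1 * `|T (w - v)|) ^+ 2 <= c * Q (2^-1 *: (w - v)).
      by rewrite ler_pM2l.
    lra.
  have h5 : `|T (w - v)| ^+ 2 < e ^+ 2.
    rewrite -(ltr_pM2l c_gt0); move: h4; rewrite /r exprMn => h4.
    have : 0 < c * e ^+ 2 by rewrite mulr_gt0// exprn_gt0.
    lra.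
  by rewrite -(@ltr_pXn2r _ 2) ?nnegrE ?(ltW e0).
have /cvg_ex[z Fz] := @cauchy_cvg Z (filter_from D B) FF Fc.
exists z => A CA; apply: (Ccc _ CA).2 => e e0.
have e20 : 0 < e / 2 by rewrite divr_gt0.
have n1 : filter_from D B (ball z (e / 2)) by apply: Fz; exact: nbhsx_ballx.
have n2 : filter_from D B (B (A, e / 2, 1)) by exists (A, e / 2, 1).
have [x [/= zw [w [[a Aa aw] _] wE]]] := filter_ex (filterI n1 n2).
move: zw; rewrite -{x}wE -ball_normE /= => zw; exists a => //.
have := ler_normD (z - T w) (T w - a).
rewrite addrA subrK (distrC (T w)) => /le_lt_trans; apply.
by rewrite [ltRHS]splitr ltrD.
Qed.

(** The closed convex members of an ultrafilter containing the set have a common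
    point [z].  A closed half-space that misses [z] is therefore not a member,
    so its complement is one, which is weak convergence to [z]. *)
Lemma weakly_compact_ball_image : weakly_compact ball_image.
Proof.
have mb : midconvex ball_image.
  move=> x y Bx By e e0; have [v v1 xv] := Bx e e0; have [w w1 yw] := By e e0.
  exists (2^-1 *: (v + w)).
    have := Q_convex v w; have := Q_ge0 (2^-1 *: (v - w)) => h1 h2.
    have : 0 <= c * Q (2^-1 *: (v - w)) by rewrite mulr_ge0// ltW.
    lra.
  rewrite [T (_ *: _)]linearZ_LR [T (_ + _)]linearD -scalerBr opprD addrACA.
  rewrite normrZ ger0_norm ?invr_ge0//.
  have := ler_normD (x - T v) (y - T w); lra.
have nb : norm_closed ball_image.
  move=> z H e e0; have e20 : 0 < e / 2 by rewrite divr_gt0.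
  have [a Ba za] := H _ e20; have [w w1 aw] := Ba _ e20.
  exists w => //; have := ler_normD (z - a) (a - T w).
  by rewrite addrA subrK; lra.
apply/weakly_compactP => F UF FB.
pose C := [set A : set Z | [/\ F A, midconvex A & norm_closed A]].
have [||||z Hz] := @convex_family_inter C.
- by exists ball_image.
- move=> A B [FA cA nA] [FB' cB nB]; split; first exact: filterI.
    by move=> x y [? ?] [? ?]; split; [exact: cA|exact: cB].
  by move=> z H; split; [apply: nA|apply: nB] => e e0;
    have [a [? ?] ?] := H e e0; exists a.
- by move=> A [].
- move=> A e [FA _ _] e0; have [z [Az Bz]] := filter_ex (filterI FA FB).
  by have [w w1 zw] := Bz e e0; exists w => //; exists z.
have closed_half (f : dual Z) (a t : R) :
    norm_closed [set z | a * (sval f z : R) <= t].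
  move=> x H /=; rewrite leNgt; apply/negP => lt.
  have [M M0 HM] := dual_bounded f.
  have aM0 : 0 < (`|a| + 1) * M by rewrite mulr_gt0// ltr_wpDl.
  have [|y /= yt xy] := H ((a * (sval f x : R) - t) / ((`|a| + 1) * M)).
    by rewrite divr_gt0// subr_gt0.
  move: xy; rewrite ltr_pdivlMr// => xy.
  have : a * (sval f x : R) - a * (sval f y : R) <= (`|a| + 1) * M * `|x - y|.
    rewrite -mulrBr (le_trans (ler_norm _))// normrM -mulrA ler_pM//.
      by rewrite lerDl.
    by have := HM (x - y); rewrite linearB.
  lra.
have convex_half (f : dual Z) (a t : R) :
    midconvex [set z | a * (sval f z : R) <= t].
  move=> x y /= hx hy; rewrite (linearZ_LR (sval f)) (linearD (sval f)) /=.
  rewrite -[_ *: _]/(_ * _) mulrCA mulrDr; lra.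
have half (f : dual Z) (a t : R) : a * (sval f z : R) < t ->
    F [set x | a * (sval f x : R) < t].
  move=> zt.
  have [//|FC] := in_ultra_setVsetC [set x | a * (sval f x : R) < t] UF.
  have : [set x | - a * (sval f x : R) <= - t] z.
    apply: Hz; split; [|exact: convex_half|exact: closed_half].
    by apply: filterS FC => x /= /negP; rewrite -leNgt mulNr lerN2.
  by rewrite /= mulNr lerN2 leNgt zt.
exists z; first by apply: Hz.
move=> f; apply/cvgrPdist_lt => e e0.
have := half f 1 (sval f z + e); rewrite mul1r ltrDl => /(_ e0) F1.
have := half f (-1) (- sval f z + e); rewrite mulN1r ltrDl => /(_ e0) F2.
apply: filterS2 F1 F2 => x /=; rewrite !mulN1r !mul1r => h1 h2.
rewrite ltr_norml; apply/andP; split; lra.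
Qed.

End ConvexIntersection.

(** * Null unions and boundedness *)

Section WeaklyCompactSets.
Context (R : realType) (Z : normedModType R).

(** An ultrafilter that contains none of the sets avoids any finite number of
    them, so it converges to 0 in norm. *)
Lemma weakly_compact_null_union (G : nat -> set Z) :
  (forall n, weakly_compact (G n)) ->
  (forall n z, G n z -> `|z| <= n.+1%:R^-1) ->
  weakly_compact ([set 0] `|` \bigcup_n G n).
Proof.
move=> Gc Gsmall; apply/weakly_compactP => F UF FG.
have [[n Fn]|nF] := pselect (exists n, F (G n)).
  have [z Gz Hz] := (weakly_compactP _).1 (Gc n) F UF Fn.
  by exists z => //; right; exists n.
have FC n : F (~` G n).
  by have [Fn|//] := in_ultra_setVsetC (G n) UF; case: nF; exists n.
exists 0; first by left.
have Fball (e : R) : 0 < e -> F [set z | `|z| < e].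
  move=> e0; have [N _ HN] := near_infty_natSinv_lt (PosNum e0).
  have FN : F [set z | forall n, (n < N)%N -> ~ G n z].
    elim: N {HN} => [|N IH]; first by apply: filterS filterT => z _ n.
    apply: filterS2 IH (FC N) => z H1 H2 n.
    by rewrite ltnS leq_eqVlt => /predU1P[->//|/H1].
  apply: filterS2 FG FN => z [->|[n _ Gn]] H /=; first by rewrite normr0.
  rewrite (le_lt_trans (Gsmall n z Gn))//; apply: HN => /=.
  by rewrite leqNgt; apply/negP => /H.
move=> f; apply/cvgrPdist_lt => e e0.
have [M M0 HM] := dual_bounded f.
apply: filterS (Fball (e / M) (divr_gt0 e0 M0)) => z /=.
rewrite ltr_pdivlMr// linear0 sub0r normrN mulrC; exact: le_lt_trans.
Qed.

(** The bound on the absolute partial sums makes the pointwise sum a bounded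
    functional, and bounds on the tails of the series survive in the limit. *)
Lemma dual_series (b : nat -> dual Z) (C : R) :
  (forall N z, \sum_(0 <= i < N) `|sval (b i) z : R| <= C * `|z|) ->
  exists2 f : dual Z,
    forall z, series (fun i => sval (b i) z : R) @ \oo --> (sval f z : R) &
    forall z N e, (forall M, \sum_(N <= i < M) `|sval (b i) z : R| <= e) ->
      `|sval f z - \sum_(0 <= i < N) (sval (b i) z : R)| <= e.
Proof.
move=> bC; pose s z := series (fun i => sval (b i) z : R).
have sc z : cvgn (s z).
  apply: normed_cvg; apply: nondecreasing_is_cvgn.
    apply: nondecreasing_series => i _ _; exact: normr_ge0.
  by exists (C * `|z|) => _ [N _ <-]; exact: bC.
pose g z := limn (s z).
have gC z : `|g z| <= C * `|z|.
  rewrite /g -lim_norm//; apply: limr_le; first exact: is_cvg_norm.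
  apply: nearW => N; exact: le_trans (ler_norm_sum _ _ _) (bC _ _).
have glin a x y : g (a *: x + y) = a * g x + g y.
  apply/cvg_lim => //.
  have -> : s (a *: x + y) = (fun N => a * s x N + s y N).
    apply/funext => N; rewrite /s /series /= mulr_sumr -big_split /=.
    by apply: eq_bigr => i _; rewrite linearP.
  by apply: cvgD; [apply: cvgMr|]; exact: sc.
have [f fg] := dual_of_bounded glin gC.
exists f; first by move=> z; rewrite fg; exact: sc.
move=> z N e Ne.
have sN : s z n - s z N @[n --> \oo] --> sval f z - s z N.
  by rewrite fg; apply: cvgB; [exact: sc|exact: cvg_cst].
rewrite -[X in `|X| <= _](cvg_lim _ sN)// -lim_norm; last exact: cvgP sN.
apply: limr_le; first by apply: is_cvg_norm; exact: cvgP sN.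
exists N => // n /= Nn; rewrite /s sub_series Nn.
exact: le_trans (ler_norm_sum _ _ _) (Ne n).
Qed.

(** If the norms of [u n] grow fast enough, a signed sum of norming functionals
    with weights 3^-n is at least [n] in absolute value at [u n], whereas it
    should return close to its value at a cluster point. *)
Lemma weakly_compact_bounded (K : set Z) : weakly_compact K ->
  exists M : R, forall z, K z -> `|z| <= M.
Proof.
move=> Kc; apply: contrapT => unb.
have step n : exists z, K z /\ n%:R * 2 * 3 ^+ n < `|z|.
  apply: contrapT => H; apply: unb; exists (n%:R * 2 * 3 ^+ n) => z Kz.
  by rewrite leNgt; apply/negP => zn; apply: H; exists z.
have [u Hu] := choice step; have [f Hf] := choice (@norming_functional R Z).
(* The signs make the partial sums at [u n] at least as large as their last
   term, and the remaining terms add up to at most half of that. *)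
pose phi := fix phi n : Z -> R := if n is m.+1 then
  fun z => phi m z + (if 0 <= phi m (u m) then 1 else -1) * 3^-1 ^+ m * sval (f (u m)) z
  else fun=> 0.
pose c n : R := (if 0 <= phi n (u n) then 1 else -1) * 3^-1 ^+ n.
have c_norm n : `|c n| = 3^-1 ^+ n.
  rewrite /c normrM normrX [ `|3^-1| ]ger0_norm ?invr_ge0//.
  by case: ifP => _; rewrite ?normrN1 ?normr1 mul1r.
have fb n z : `|sval (f (u n)) z : R| <= `|z| by exact: (Hf (u n)).1.
have step2 n : exists b : dual Z, forall z, sval b z = c n * sval (f (u n)) z :> R.
  apply: (@dual_of_bounded _ _ _ `|c n|).
    by move=> a x y; rewrite linearP /= mulrDr; congr (_ + _); exact: mulrCA.
  by move=> z; rewrite normrM ler_wpM2l.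
have [b Hb] := choice step2.
have geo (N M : nat) : \sum_(N <= i < M) 3^-1 ^+ i <= 3 / 2 * 3^-1 ^+ N :> R.
  have [NM|MN] := leqP N M; last first.
    by rewrite big_geq ?mulr_ge0 ?exprn_ge0 ?invr_ge0// ltnW.
  have -> : \sum_(N <= i < M) 3^-1 ^+ i = 3 / 2 * (3^-1 ^+ N - 3^-1 ^+ M) :> R.
    rewrite -(subnKC NM); elim: (M - N)%N => [|k IH].
      by rewrite addn0 big_geq// subrr mulr0.
    by rewrite addnS big_nat_recr ?leq_addr//= IH exprS; field.
  by rewrite ler_pM2l// gerBl exprn_ge0// invr_ge0.
have bsum N M z : \sum_(N <= i < M) `|sval (b i) z : R| <= 3 / 2 * 3^-1 ^+ N * `|z|.
  apply: (@le_trans _ _ ((\sum_(N <= i < M) 3^-1 ^+ i) * `|z|)); last first.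
    by rewrite ler_wpM2r.
  rewrite mulr_suml; apply: ler_sum => i _.
  by rewrite Hb normrM c_norm ler_wpM2l// exprn_ge0// invr_ge0.
have [|g _ Hg] := @dual_series b (3 / 2).
  by move=> N z; have := bsum 0%N N z; rewrite expr0 mulr1.
have phiE n z : \sum_(0 <= i < n) (sval (b i) z : R) = phi n z.
  by elim: n => [|n IH]; [rewrite big_geq|rewrite big_nat_recr//= IH Hb].
have phi_u n : 3^-1 ^+ n * `|u n| <= `|phi n.+1 (u n)|.
  have -> : phi n.+1 (u n) = phi n (u n) + c n * `|u n|.
    by rewrite /= (Hf (u n)).2.
  have e0 : 0 <= 3^-1 ^+ n * `|u n| by rewrite mulr_ge0// exprn_ge0// invr_ge0.
  rewrite /c; case: ifP => h; rewrite ?mul1r ?mulN1r ?mulNr.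
    by rewrite ger0_norm ?addr_ge0//; lra.
  by rewrite ler0_norm; move/negbT: h; rewrite -ltNge => h; lra.
have gu n : n%:R <= `|sval g (u n) : R|.
  have h1 := phi_u n; have h2 := Hg (u n) n.+1 _ (fun M => bsum n.+1 M (u n)).
  rewrite phiE in h2; have h3 := (Hu n).2.
  have h4 : `|phi n.+1 (u n)| <= `|sval g (u n) : R| + `|sval g (u n) - phi n.+1 (u n)|.
    by have := ler_normB (sval g (u n) : R) (sval g (u n) - phi n.+1 (u n)); rewrite subKr.
  have h5 : n%:R * 2 <= 3^-1 ^+ n * `|u n|.
    by rewrite [leRHS]mulrC exprVn ler_pdivlMr ?exprn_gt0// ltW.
  by move: h2; rewrite exprS => h2; lra.
have [w Kw Hw] := weak_cluster Kc (fun n => (Hu n).1).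
have [n nN] := Hw [:: g] 1 (Num.trunc (`|sval g w : R| + 1)).+1 ltr01.
move=> /(_ g (or_introl erefl)) h.
have : `|sval g (u n) : R| < `|sval g w : R| + 1.
  by have := ler_normD (sval g (u n) - sval g w : R) (sval g w); rewrite subrK; lra.
apply/negP; rewrite -leNgt (le_trans _ (gu n))//.
have := truncnS_gt (`|sval g w : R| + 1) => /ltW /le_trans; apply.
by rewrite ler_nat.
Qed.

End WeaklyCompactSets.

(** * The projective tensor product *)

Lemma bilinear_forZl (R : realType) (X Y V : lmodType R) (phi : X -> Y -> V) :
  bilinear_for *:%R *:%R phi -> forall a x y, phi (a *: x) y = a *: phi x y.
Proof. by move=> h a x y; have := scalable_linear (h.1 y) a x. Qed.

Lemma bilinear_forZr (R : realType) (X Y V : lmodType R) (phi : X -> Y -> V) :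
  bilinear_for *:%R *:%R phi -> forall a x y, phi x (a *: y) = a *: phi x y.
Proof. by move=> h a x y; have := scalable_linear (h.2 x) a y. Qed.

Lemma bilinear_forDl (R : realType) (X Y V : lmodType R) (phi : X -> Y -> V) :
  bilinear_for *:%R *:%R phi -> forall x x' y, phi (x + x') y = phi x y + phi x' y.
Proof. by move=> h x x' y; have := h.1 y 1 x x'; rewrite /= !scale1r. Qed.

Lemma bilinear_forDr (R : realType) (X Y V : lmodType R) (phi : X -> Y -> V) :
  bilinear_for *:%R *:%R phi -> forall x y y', phi x (y + y') = phi x y + phi x y'.
Proof. by move=> h x y y'; have := h.2 x 1 y y'; rewrite /= !scale1r. Qed.

Section ProjectiveTensorProduct.
Context (R : realType) (X Y : normedModType R).
Local Notation Z := (projective_tensor X Y).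

Definition tens (x : X) (y : Y) : Z :=
  completion_inj (proj_seminorm X Y) (elem_tensor x y).

Definition tens_sum (s : seq (X * Y)) : Z := \sum_(z <- s) tens z.1 z.2.

Definition tens_cost (s : seq (X * Y)) : R := \sum_(z <- s) `|z.1| * `|z.2|.

Lemma tens_sumE s :
  tens_sum s = completion_inj (proj_seminorm X Y) (\sum_(z <- s) elem_tensor z.1 z.2).
Proof. by rewrite raddf_sum. Qed.

Lemma tens_bilinear : bilinear_for *:%R *:%R tens.
Proof.
split=> [y|x] a u v; rewrite /tens -linearP; congr (completion_inj _ _);
  apply/val_inj/funext => A; by rewrite /= /eval_at ?linearPl ?linearPr.
Qed.

Lemma norm_tens_sum s : `|tens_sum s| <= tens_cost s.
Proof.
rewrite tens_sumE [leLHS]completion_norm_inj; apply: ge_inf.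
  by case: (proj_costs_has_inf (\sum_(z <- s) elem_tensor z.1 z.2)).
by exists s.
Qed.

Lemma norm_tens x y : `|tens x y| <= `|x| * `|y|.
Proof.
by have := norm_tens_sum [:: (x, y)]; rewrite /tens_sum /tens_cost !big_seq1.
Qed.

(** The bound on the cost is what distinguishes the projective norm: estimates
    on elementary tensors pass to all tensors with the same constant. *)
Lemma tens_dense (z : Z) (e : R) : 0 < e ->
  exists2 s, `|z - tens_sum s| < e & tens_cost s < `|z| + e.
Proof.
move=> e0; have e20 : 0 < e / 2 by rewrite divr_gt0.
have [v zv] := completion_dense z e20.
have [c [s /= vs <-] sc] := inf_adherent e20 (proj_costs_has_inf v).
exists s; first by rewrite tens_sumE -vs; lra.
have : proj_seminorm X Y v <= `|z| + e / 2.
  rewrite -completion_norm_inj.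
  have := ler_normB z (z - completion_inj (proj_seminorm X Y) v).
  by rewrite subKr => /le_trans; apply; rewrite lerD2l ltW.
by move: sc; rewrite /tens_cost /= /proj_norm; lra.
Qed.

Section Universal.
Context (V : completeNormedModType R) (phi : X -> Y -> V) (C : R).
Hypothesis phi_bilinear : bilinear_for *:%R *:%R phi.
Hypothesis C_gt0 : 0 < C.
Hypothesis phi_le : forall x y, `|phi x y| <= C * (`|x| * `|y|).

Let phi_sum (s : seq (X * Y)) : V := \sum_(z <- s) phi z.1 z.2.

(** A real functional composed with [phi] is a bilinear form, hence is computed
    by the tensor; norming functionals then separate the values of [phi]. *)
Let phi_sum_wd s t :
  \sum_(z <- s) elem_tensor z.1 z.2 = \sum_(z <- t) elem_tensor z.1 z.2 ->
  phi_sum s = phi_sum t.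
Proof.
move=> st; have [f [_ Hf]] := norming_functional (phi_sum s - phi_sum t).
have fphi : bilinear_for *:%R *:%R (fun x y => sval f (phi x y)).
  by split=> [y|x] a u v; rewrite ?phi_bilinear.1 ?phi_bilinear.2 linearP.
pose B0 := bilinear_isBilinear.Build R X Y R^o _ _ _ fphi.
pose B : {bilinear X -> Y -> R^o} := HB.pack (fun x y => sval f (phi x y)) B0.
have Bs r : tensor_val (\sum_(z <- r) elem_tensor z.1 z.2) B = sval f (phi_sum r).
  rewrite /phi_sum linear_sum; elim: r => [|z r IH]; first by rewrite !big_nil.
  by rewrite !big_cons -IH.
have : sval f (phi_sum s - phi_sum t) = 0 by rewrite linearB -!Bs st subrr.
by rewrite Hf => /eqP; rewrite normr_eq0 subr_eq0 => /eqP.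
Qed.

Let phi_sum_le s : `|phi_sum s| <= C * `|tens_sum s|.
Proof.
rewrite tens_sumE completion_norm_inj -ler_pdivrMl//.
apply: lb_le_inf => [|_ [t /= st <-]].
  by case: (proj_costs_has_inf (\sum_(z <- s) elem_tensor z.1 z.2)).
rewrite ler_pdivrMl// (phi_sum_wd st) mulr_sumr.
apply: le_trans (ler_norm_sum _ _ _) _; exact: ler_sum.
Qed.

(** The universal property.  [T z] is the limit of the sums of values of [phi]
    along the finite sums of elementary tensors that approach [z]; the estimate
    [HT] against all such sums determines it, and linearity follows. *)
Lemma tensor_lift : exists T : {linear Z -> V},
  (forall x y, T (tens x y) = phi x y) /\ forall z, `|T z| <= C * `|z|.
Proof.
have phi_sumB s t : exists r, phi_sum s - phi_sum t = phi_sum r /\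
    tens_sum s - tens_sum t = tens_sum r.
  exists (s ++ [seq ((-1) *: z.1, z.2) | z <- t]); rewrite /phi_sum /tens_sum.
  rewrite !big_cat/= !big_map -!sumrN; split; congr (_ + _);
    apply: eq_bigr => z _ /=; rewrite -scaleN1r.
    by rewrite (bilinear_forZl phi_bilinear).
  by rewrite (bilinear_forZl tens_bilinear).
have lip s t : `|phi_sum s - phi_sum t| <= C * `|tens_sum s - tens_sum t|.
  by have [r [-> ->]] := phi_sumB s t; exact: phi_sum_le.
have scaled (a e : R) : a < e / 2 / C -> C * a < e / 2.
  by rewrite ltr_pdivlMr// mulrC.
have step z : exists y : V, forall s, `|y - phi_sum s| <= C * `|z - tens_sum s|.
  pose F := filter_from [set e : R | 0 < e]
    (fun e => phi_sum @` [set s | `|z - tens_sum s| < e]).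
  have FF : ProperFilter F.
    apply: filter_from_proper; last first.
      by move=> e /(tens_dense z)[s zs _]; exists (phi_sum s), s.
    apply: filter_from_filter; first by exists 1 => /=.
    move=> e e' /= e0 e0'; exists (Num.min e e'); first by rewrite /= lt_min e0.
    by move=> _ [s /= + <-]; rewrite lt_min => /andP[? ?]; split; exists s.
  have dist2 s t : `|tens_sum s - tens_sum t| <= `|z - tens_sum s| + `|z - tens_sum t|.
    have := ler_normD (tens_sum s - z) (z - tens_sum t).
    by rewrite addrA subrK (distrC _ z).
  have Fc : cauchy F.
    apply/cauchy_exP => e e0.
    have d0 : 0 < e / 2 / C by rewrite !divr_gt0.
    have [s zs _] := tens_dense z d0.
    exists (phi_sum s), (e / 2 / C) => // _ [t /= zt <-].
    rewrite -ball_normE /ball_ /=; apply: le_lt_trans (lip s t) _.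
    have := scaled _ _ zs; have := scaled _ _ zt; have := dist2 s t.
    by rewrite -(ler_pM2l C_gt0) mulrDr; lra.
  have /cvg_ex[y Fy] := @cauchy_cvg V F FF Fc.
  exists y => s; apply/ler_addgt0Pr => e e0.
  have d0 : 0 < e / 2 / C by rewrite !divr_gt0.
  have n1 : F (ball y (e / 2)) by apply: Fy; apply: nbhsx_ballx; rewrite divr_gt0.
  have n2 : F (phi_sum @` [set s | `|z - tens_sum s| < e / 2 / C]) by exists (e / 2 / C).
  have [w [/= yw [t zt tw]]] := filter_ex (filterI n1 n2).
  move: yw; rewrite -{w}tw -ball_normE /= => yt.
  have := ler_normD (y - phi_sum t) (phi_sum t - phi_sum s); rewrite addrA subrK.
  have := lip t s; have := scaled _ _ zt; have := dist2 t s.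
  by rewrite -(ler_pM2l C_gt0) mulrDr; lra.
have [T HT] := choice step.
have small (y : V) : (forall e, 0 < e -> `|y| <= e) -> y = 0.
  move=> H; apply/eqP; rewrite -normr_le0; apply/ler_addgt0Pr => e e0.
  by rewrite add0r; exact: H.
have Tlin : linear T.
  move=> a u v; apply/eqP; rewrite -subr_eq0; apply/eqP/small => e e0.
  pose k := 2 * C * (`|a| + 1).
  have k0 : 0 < k by rewrite !mulr_gt0// ltr_wpDl.
  have d0 : 0 < e / k by rewrite divr_gt0.
  have [s us _] := tens_dense u d0; have [t vt _] := tens_dense v d0.
  pose r := [seq (a *: z.1, z.2) | z <- s] ++ t.
  have rphi : phi_sum r = a *: phi_sum s + phi_sum t.
    rewrite /phi_sum big_cat big_map scaler_sumr; congr (_ + _).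
    by apply: eq_bigr => z _ /=; rewrite (bilinear_forZl phi_bilinear).
  have rtens : tens_sum r = a *: tens_sum s + tens_sum t.
    rewrite /tens_sum big_cat big_map scaler_sumr; congr (_ + _).
    by apply: eq_bigr => z _ /=; rewrite (bilinear_forZl tens_bilinear).
  have h1 := HT (a *: u + v) r; have h2 := HT u s; have h3 := HT v t.
  have h4 : `|a *: u + v - tens_sum r| <= (`|a| + 1) * (e / k).
    rewrite rtens opprD addrACA -scalerBr (le_trans (ler_normD _ _))//.
    by rewrite normrZ mulrDl mul1r lerD ?ler_wpM2l// ltW.
  have h5 : `|T (a *: u + v) - (a *: T u + T v)| <=
      `|T (a *: u + v) - phi_sum r| + (`|a| * `|T u - phi_sum s| + `|T v - phi_sum t|).
    have -> : T (a *: u + v) - (a *: T u + T v) = (T (a *: u + v) - phi_sum r)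
        - (a *: (T u - phi_sum s) + (T v - phi_sum t)).
      by rewrite rphi scalerBr addrACA -opprD opprB addrA subrK.
    rewrite (le_trans (ler_normB _ _))// lerD2l (le_trans (ler_normD _ _))//.
    by rewrite normrZ.
  apply: le_trans h5 _.
  have h6 : `|a| * `|T u - phi_sum s| <= `|a| * (C * (e / k)).
    by rewrite ler_wpM2l// (le_trans h2)// ler_wpM2l ?(ltW C_gt0)// ltW.
  have h7 : `|T v - phi_sum t| <= C * (e / k).
    by rewrite (le_trans h3)// ler_wpM2l ?(ltW C_gt0)// ltW.
  have h8 : `|T (a *: u + v) - phi_sum r| <= C * ((`|a| + 1) * (e / k)).
    by rewrite (le_trans h1)// ler_wpM2l ?(ltW C_gt0).
  have -> : e = 2 * C * (`|a| + 1) * (e / k).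
    by rewrite -/k mulrC divfK// gt_eqF.
  lra.
pose L := GRing.isLinear.Build R Z V _ T Tlin.
pose G : {linear Z -> V} := HB.pack T L.
exists G; split=> [x y|z] /=.
  apply/eqP; rewrite -subr_eq0 -normr_le0.
  have := HT (tens x y) [:: (x, y)].
  by rewrite /phi_sum /tens_sum !big_seq1 subrr normr0 mulr0.
have := HT z [::]; by rewrite /phi_sum /tens_sum !big_nil !subr0.
Qed.

End Universal.

Lemma tensor_lift_unique (V : normedModType R) (T T' : {linear Z -> V}) (C : R) :
  0 < C -> (forall z, `|T z| <= C * `|z|) -> (forall z, `|T' z| <= C * `|z|) ->
  (forall x y, T (tens x y) = T' (tens x y)) -> T =1 T'.
Proof.
move=> C0 TC TC' TT z; apply/eqP; rewrite -subr_eq0 -normr_le0.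
apply/ler_addgt0Pr => e e0; rewrite add0r.
have d0 : 0 < e / (2 * C) by rewrite divr_gt0// mulr_gt0.
have [s zs _] := tens_dense z d0.
have Ts : T (tens_sum s) = T' (tens_sum s).
  by rewrite !linear_sum; apply: eq_bigr.
have -> : T z - T' z = T (z - tens_sum s) - T' (z - tens_sum s).
  by rewrite (linearB T) (linearB T') Ts opprB addrA subrK.
have := ler_normB (T (z - tens_sum s)) (T' (z - tens_sum s)).
have := TC (z - tens_sum s); have := TC' (z - tens_sum s).
by move: zs; rewrite ltr_pdivlMr ?mulr_gt0//; lra.
Qed.

End ProjectiveTensorProduct.

(** * Nested projections of finite rank *)

(** Finite rank is expressed by bounded coordinates, since the coordinates are
    what turns a tensor into an element of a finite power of the other
    factor. *)
Record finite_rank_approximation (R : realType) (X : normedModType R) := {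
  proj :> nat -> {linear X -> X};
  proj_le : forall n x, `|proj n x| <= `|x|;
  proj_le_proj : forall n m x, (n <= m)%N -> proj n (proj m x) = proj n x;
  proj_ge_proj : forall n m x, (n <= m)%N -> proj m (proj n x) = proj n x;
  proj_cvg : forall x (e : R), 0 < e ->
    exists N, forall n, (N <= n)%N -> `|x - proj n x| < e;
  proj_coord : forall n, exists d (e : 'I_d -> X) (a : 'I_d -> {linear X -> R^o}),
    (forall x, proj n x = \sum_i (a i x : R) *: e i) /\
    exists2 C : R, 0 < C & forall i x, `|a i x : R| <= C * `|x| }.

Section Approximation.
Context (R : realType) (X : normedModType R) (P : finite_rank_approximation X).
Context (c : R) (c_gt0 : 0 < c).
Hypothesis X_convex : two_convex c (fun x : X => `|x| ^+ 2).

Lemma norm_coproj n x : `|x - P n x| <= 2 * `|x|.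
Proof. by rewrite (le_trans (ler_normB _ _))//; have := proj_le P n x; lra. Qed.

Lemma norm_block n m x : `|P m x - P n x| <= 2 * `|x|.
Proof.
rewrite (le_trans (ler_normB _ _))//.
by have := proj_le P n x; have := proj_le P m x; lra.
Qed.

(** The midpoint of [P m x] and [P n x] is sent by [P n] to [P n x], so its norm
    is at least that of [P n x], and convexity measures the excess. *)
Lemma block_convex n m x : (n <= m)%N ->
  `|P n x| ^+ 2 + c / 2 * `|P m x - P n x| ^+ 2 <= `|P m x| ^+ 2.
Proof.
move=> nm; have := X_convex (P m x) (P n x).
have : `|P n x| ^+ 2 <= `|2^-1 *: (P m x + P n x)| ^+ 2.
  rewrite ler_pXn2r ?nnegrE//.
  have E : P n (2^-1 *: (P m x + P n x)) = P n x.
    rewrite (linearZ_LR (P n)) (linearD (P n)) !proj_le_proj//.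
    by rewrite -mulr2n -(scaler_nat 2 (P n x)) scalerA mulVf ?scale1r// pnatr_eq0.
  by rewrite -[in leLHS]E proj_le.
rewrite [ `|_ *: (_ - _)| ]normrZ ger0_norm ?invr_ge0// exprMn; lra.
Qed.

(** The inequality [block_convex] telescopes along successive blocks. *)
Lemma sum_block_le (n m : nat -> nat) x N :
  (forall i, (n i <= m i)%N) -> (forall i, (m i <= n i.+1)%N) ->
  c / 2 * (\sum_(0 <= i < N) `|P (m i) x - P (n i) x| ^+ 2) <= `|x| ^+ 2.
Proof.
move=> nm mn.
suff : c / 2 * (\sum_(0 <= i < N) `|P (m i) x - P (n i) x| ^+ 2) <= `|P (n N) x| ^+ 2.
  by move=> /le_trans; apply; rewrite ler_pXn2r ?nnegrE//; exact: proj_le.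
elim: N => [|N IH]; first by rewrite big_geq// mulr0 exprn_ge0.
rewrite big_nat_recr//= mulrDr (le_trans (lerD IH (lexx _)))//.
rewrite (le_trans (block_convex x (nm N)))// ler_pXn2r ?nnegrE//.
by rewrite -(proj_le_proj P x (mn N)) proj_le.
Qed.

End Approximation.

Section TensorOperators.
Context (R : realType) (X Y : normedModType R).
Local Notation Z := (projective_tensor X Y).

Lemma tens_map (f : {linear X -> X}) (g : {linear Y -> Y}) (a b : R) :
  0 < a -> 0 < b ->
  (forall x, `|f x| <= a * `|x|) -> (forall y, `|g y| <= b * `|y|) ->
  exists T : {linear Z -> Z}, (forall x y, T (tens x y) = tens (f x) (g y)) /\
    forall z, `|T z| <= a * b * `|z|.
Proof.
move=> a0 b0 fa gb.
apply: (@tensor_lift _ _ _ Z (fun x y => tens (f x) (g y))) => [||x y].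
- split=> [y|x] k u v.
    by rewrite linearP (tens_bilinear _ _).1.
  by rewrite linearP (tens_bilinear _ _).2.
- by rewrite mulr_gt0.
- by rewrite (le_trans (norm_tens _ _))// mulrACA ler_pM.
Qed.

Lemma tens_strong_cvg (T : nat -> {linear Z -> Z}) (C : R) :
  (forall n z, `|T n z| <= C * `|z|) ->
  (forall x y (e : R), 0 < e ->
    exists N, forall n, (N <= n)%N -> `|T n (tens x y)| < e) ->
  forall z (e : R), 0 < e -> exists N, forall n, (N <= n)%N -> `|T n z| < e.
Proof.
move=> TC Te z e e0.
have e20 : 0 < e / 2 by rewrite divr_gt0.
have C0 : 0 < `|C| + 1 by rewrite ltr_wpDl.
have [s zs _] := tens_dense z (divr_gt0 e20 C0).
have [N HN] : exists N, forall n, (N <= n)%N -> `|T n (tens_sum s)| < e / 2.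
  elim: s (e / 2) e20 {zs} => [|[x y] s IH] d d0.
    by exists 0%N => n _; rewrite /tens_sum big_nil linear0 normr0.
  have [|N1 H1] := Te x y (d / 2); first by rewrite divr_gt0.
  have [|N2 H2] := IH (d / 2); first by rewrite divr_gt0.
  exists (maxn N1 N2) => n; rewrite geq_max => /andP[n1 n2].
  rewrite /tens_sum big_cons linearD [d]splitr (le_lt_trans (ler_normD _ _))//.
  by rewrite ltrD// ?H1// H2.
exists N => n Nn; have := HN n Nn; have := TC n (z - tens_sum s).
have := ler_normD (T n (z - tens_sum s)) (T n (tens_sum s)).
rewrite -linearD subrK; move: zs; rewrite ltr_pdivlMr// => zs h1 h2 h3.
have : C * `|z - tens_sum s| <= (`|C| + 1) * `|z - tens_sum s|.
  by rewrite ler_wpM2r// (le_trans (ler_norm C))// lerDl.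
by rewrite [X in _ <= X]mulrC; lra.
Qed.

End TensorOperators.

(** * Tails on weakly compact sets *)

Section Tails.
Context (R : realType) (X Y : normedModType R).
Context (P : finite_rank_approximation X) (Q : finite_rank_approximation Y).
Context (c : R) (c_gt0 : 0 < c).
Hypothesis X_convex : two_convex c (fun x : X => `|x| ^+ 2).
Hypothesis Y_convex : two_convex c (fun y : Y => `|y| ^+ 2).
Local Notation Z := (projective_tensor X Y).

Lemma tail_operators : exists S : nat -> {linear Z -> Z},
  (forall n x y, S n (tens x y) = tens (x - P n x) (y - Q n y)) /\
  forall n z, `|S n z| <= 4 * `|z|.
Proof.
have step n : exists S : {linear Z -> Z},
    (forall x y, S (tens x y) = tens (x - P n x) (y - Q n y)) /\
    forall z, `|S z| <= 2 * 2 * `|z|.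
  by apply: (@tens_map _ _ _ (idfun \- P n) (idfun \- Q n) 2 2) => // x;
    exact: norm_coproj.
have [S HS] := choice step; exists S; split=> n.
  exact: (HS n).1.
by move=> z; have := (HS n).2 z; rewrite -natrM.
Qed.

Lemma block_operators : exists D : nat -> nat -> {linear Z -> Z},
  (forall n m x y, D n m (tens x y) = tens (P m x - P n x) (Q m y - Q n y)) /\
  forall n m z, `|D n m z| <= 4 * `|z|.
Proof.
have step (i : nat * nat) : exists D : {linear Z -> Z},
    (forall x y, D (tens x y) = tens (P i.2 x - P i.1 x) (Q i.2 y - Q i.1 y)) /\
    forall z, `|D z| <= 2 * 2 * `|z|.
  by apply: (@tens_map _ _ _ (P i.2 \- P i.1) (Q i.2 \- Q i.1) 2 2) => // x;
    exact: norm_block.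
have [D HD] := choice step; exists (fun n m => D (n, m)); split=> n m.
  exact: (HD (n, m)).1.
by move=> z; have := (HD (n, m)).2 z; rewrite -natrM.
Qed.

Context (S : nat -> {linear Z -> Z}) (D : nat -> nat -> {linear Z -> Z}).
Hypothesis S_tens : forall n x y, S n (tens x y) = tens (x - P n x) (y - Q n y).
Hypothesis S_le : forall n z, `|S n z| <= 4 * `|z|.
Hypothesis D_tens : forall n m x y,
  D n m (tens x y) = tens (P m x - P n x) (Q m y - Q n y).
Hypothesis D_le : forall n m z, `|D n m z| <= 4 * `|z|.

Lemma tail_cvg0 z (e : R) : 0 < e ->
  exists N, forall n, (N <= n)%N -> `|S n z| < e.
Proof.
move: z e; apply: tens_strong_cvg S_le _ => x y e e0.
have d0 : 0 < 2 * `|y| + 1 by rewrite ltr_wpDl// mulr_ge0.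
have [N HN] := proj_cvg P x (divr_gt0 e0 d0).
exists N => n /HN; rewrite ltr_pdivlMr// => h; rewrite S_tens.
apply: le_lt_trans (norm_tens _ _) _; apply: le_lt_trans h.
by rewrite ler_wpM2l// (le_trans (norm_coproj Q n y))// lerDl.
Qed.

Lemma block_cvg_tail n z (e : R) : 0 < e ->
  exists N, forall m, (N <= m)%N -> `|S n z - D n m z| < e.
Proof.
move: z e; apply: (@tens_strong_cvg _ _ _ (fun m => S n \- D n m) 8).
  move=> m z; rewrite /= (le_trans (ler_normB _ _))//.
  by have := S_le n z; have := D_le n m z; lra.
move=> x y e e0; have e20 : 0 < e / 2 by rewrite divr_gt0.
have d1 : 0 < 2 * `|y| + 1 by rewrite ltr_wpDl// mulr_ge0.
have d2 : 0 < 2 * `|x| + 1 by rewrite ltr_wpDl// mulr_ge0.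
have [N1 H1] := proj_cvg P x (divr_gt0 e20 d1).
have [N2 H2] := proj_cvg Q y (divr_gt0 e20 d2).
exists (maxn N1 N2) => m; rewrite geq_max => /andP[/H1 h1 /H2 h2] /=.
move: h1 h2; rewrite (ltr_pdivlMr _ _ d1) (ltr_pdivlMr _ _ d2) S_tens D_tens => h1 h2.
have -> : tens (x - P n x) (y - Q n y) - tens (P m x - P n x) (Q m y - Q n y) =
    tens (x - P m x) (y - Q n y) + tens (P m x - P n x) (y - Q m y).
  have -> : x - P n x = (x - P m x) + (P m x - P n x) by rewrite addrA subrK.
  rewrite (bilinear_forDl (@tens_bilinear _ X Y)) -addrA; congr (_ + _).
  have -> : y - Q n y = (y - Q m y) + (Q m y - Q n y) by rewrite addrA subrK.
  by rewrite (bilinear_forDr (@tens_bilinear _ X Y)) addrK.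
rewrite [e]splitr (le_lt_trans (ler_normD _ _))// ltrD//.
  apply: le_lt_trans (norm_tens _ _) _; apply: le_lt_trans h1.
  by rewrite ler_wpM2l// (le_trans (norm_coproj Q n y))// lerDl.
apply: le_lt_trans (norm_tens _ _) _; apply: le_lt_trans h2.
by rewrite mulrC ler_wpM2l// (le_trans (norm_block P n m x))// lerDl.
Qed.

(** Blocks beyond [l] do not see the difference between [z] and its tail, so a
    sum of such blocks at [z] is controlled by the norm of [S l z]. *)
Lemma block_tail l n m z : (l <= n)%N -> (n <= m)%N -> D n m (S l z) = D n m z.
Proof.
move=> ln nm; move: z.
apply: (@tensor_lift_unique _ _ _ _ (D n m \o S l) (D n m) 16) => //.
- move=> z /=; apply: le_trans (D_le _ _ _) _.
  by have := S_le l z; lra.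
- by move=> z; apply: le_trans (D_le _ _ _) _; rewrite ler_wpM2r// ler_nat.
move=> x y /=; rewrite S_tens !D_tens.
have lm := leq_trans ln nm.
rewrite (linearB (P m)) (linearB (P n)) (linearB (Q m)) (linearB (Q n)).
rewrite !proj_ge_proj//.
by congr tens; rewrite opprB addrA subrK.
Qed.

(** On an elementary tensor the i-th term is at most |a_i| |b_i| with
    a_i, b_i the blocks of the factors, and [sum_block_le] bounds both
    sums of squares.  The constant passes to all of [Z] because the projective
    norm is the infimum of the costs. *)
Lemma sum_blocks_le (n m : nat -> nat) (B : nat -> dual Z) N z :
  (forall i, (n i <= m i)%N) -> (forall i, (m i <= n i.+1)%N) ->
  (forall i z, `|sval (B i) z : R| <= `|z|) ->
  \sum_(0 <= i < N) `|sval (B i) (D (n i) (m i) z) : R| <= 2 / c * `|z|.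
Proof.
move=> nm mn B1.
have elem x y : \sum_(0 <= i < N) `|D (n i) (m i) (tens x y)| <= 2 / c * (`|x| * `|y|).
  have [->|x0] := eqVneq x 0.
    rewrite normr0 mul0r mulr0 big1// => i _.
    rewrite D_tens (linear0 (P (m i))) (linear0 (P (n i))) subr0 -[X in tens X](scale0r 0).
    by rewrite (bilinear_forZl (@tens_bilinear _ X Y)) scale0r normr0.
  have [->|y0] := eqVneq y 0.
    rewrite normr0 !mulr0 big1// => i _.
    rewrite D_tens (linear0 (Q (m i))) (linear0 (Q (n i))) subr0 -[X in tens _ X](scale0r 0).
    by rewrite (bilinear_forZr (@tens_bilinear _ X Y)) scale0r normr0.
  have nx : 0 < `|x| by rewrite normr_gt0.
  have ny : 0 < `|y| by rewrite normr_gt0.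
  have am i : `|D (n i) (m i) (tens x y)| <= `|x| * `|y| / 2 *
      (`|P (m i) x - P (n i) x| ^+ 2 / `|x| ^+ 2 + `|Q (m i) y - Q (n i) y| ^+ 2 / `|y| ^+ 2).
    rewrite D_tens (le_trans (norm_tens _ _))//.
    set a := `|P _ x - _|; set b := `|Q _ y - _|.
    (* The weighted mean inequality, with weights that balance the two sums
       of squares. *)
    have -> : `|x| * `|y| / 2 * (a ^+ 2 / `|x| ^+ 2 + b ^+ 2 / `|y| ^+ 2) =
        a * b + `|x| * `|y| / 2 * (a / `|x| - b / `|y|) ^+ 2.
      by field; rewrite !gt_eqF.
    by rewrite lerDl mulr_ge0 ?sqr_ge0// !mulr_ge0.
  have hx := sum_block_le P X_convex x N nm mn.
  have hy := sum_block_le Q Y_convex y N nm mn.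
  apply: (le_trans (ler_sum _ (fun i _ => am i))).
  rewrite -mulr_sumr big_split/= -!mulr_suml.
  have hx' : (\sum_(0 <= i < N) `|P (m i) x - P (n i) x| ^+ 2) / `|x| ^+ 2 <= 2 / c.
    by rewrite ler_pdivrMr ?exprn_gt0// -ler_pdivrMl ?divr_gt0// invf_div.
  have hy' : (\sum_(0 <= i < N) `|Q (m i) y - Q (n i) y| ^+ 2) / `|y| ^+ 2 <= 2 / c.
    by rewrite ler_pdivrMr ?exprn_gt0// -ler_pdivrMl ?divr_gt0// invf_div.
  have t0 : 0 <= `|x| * `|y| / 2 by rewrite divr_ge0// mulr_ge0.
  apply: le_trans (ler_wpM2l t0 (lerD hx' hy')) _.
  by lra.
apply/ler_addgt0Pr => e e0.
pose k : R := 4 * N%:R + 2 / c.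
have k0 : 0 < k by rewrite ltr_wpDl ?divr_gt0// mulr_ge0.
have [s zs sz] := tens_dense z (divr_gt0 e0 k0).
have hs : \sum_(0 <= i < N) `|D (n i) (m i) (tens_sum s)| <= 2 / c * tens_cost s.
  rewrite /tens_cost mulr_sumr.
  apply: (@le_trans _ _ (\sum_(0 <= i < N) \sum_(w <- s) `|D (n i) (m i) (tens w.1 w.2)|)).
    apply: ler_sum => i _; rewrite linear_sum; exact: ler_norm_sum.
  by rewrite exchange_big /=; apply: ler_sum => w _; exact: elem.
have step i : `|sval (B i) (D (n i) (m i) z) : R| <=
    4 * `|z - tens_sum s| + `|D (n i) (m i) (tens_sum s)|.
  rewrite (le_trans (B1 _ _))//.
  have := ler_normD (D (n i) (m i) (z - tens_sum s)) (D (n i) (m i) (tens_sum s)).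
  by rewrite -linearD subrK => /le_trans; apply; rewrite lerD2r.
apply: (le_trans (ler_sum _ (fun i _ => step i))).
rewrite big_split/= big_const_nat iter_addr addr0 subn0 -mulr_natr.
have h1 : 2 / c * tens_cost s <= 2 / c * (`|z| + e / k).
  by rewrite ler_wpM2l ?divr_ge0// ?(ltW c_gt0)// ltW.
have h2 : 4 * `|z - tens_sum s| * N%:R <= 4 * (e / k) * N%:R.
  by rewrite ler_wpM2r// ler_wpM2l// ltW.
have -> : e = k * (e / k) by rewrite mulrC divfK// gt_eqF.
by move: h1 h2; rewrite /k; set d := e / _; lra.
Qed.

(** Suppose that the tails stay above [e] at points [u n] of [K], and let [w] be
    a cluster point.  Since the tails of [w] vanish, [v n = u n - w] has large
    tails as well.  The gliding hump selects indices and functionals [b i], each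
    supported on a block that carries most of the tail at its own index; the
    blocks being successive, [theta], the sum of all [b i], is bounded.  At the
    j-th selected vector the terms before [b j] are small by the choice of
    the index and those after it by the choice of the block, so [theta] stays
    away from 0 there.  But every [b i], hence [theta], takes equal values at [w]
    and at a cluster point [w'] of the selected vectors. *)
Lemma weakly_compact_tail (K : set Z) (e : R) : weakly_compact K -> 0 < e ->
  exists n, forall z, K z -> `|S n z| <= e.
Proof.
move=> Kc e0; apply: contrapT => unif.
have step n : exists z, K z /\ e < `|S n z|.
  apply: contrapT => H; apply: unif; exists n => z Kz.
  by rewrite leNgt; apply/negP => zn; apply: H; exists z.
have [u Hu] := choice step => {step unif}.
have [w Kw Hw] := weak_cluster Kc (fun n => (Hu n).1).
have [N0 HN0] := @tail_cvg0 w (e / 4) (divr_gt0 e0 (ltr0Sn _ _)).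
pose v n := u n - w.
have Sv n : (N0 <= n)%N -> 3 / 4 * e < `|S n (v n)|.
  move=> /HN0 h; have := (Hu n).2; rewrite /v linearB.
  have := ler_normD (S n (u n) - S n w) (S n w); rewrite subrK; lra.
pose C := 2 / c; have C0 : 0 < C by rewrite divr_gt0.
(* One step of the gliding hump: past [l] there is an index [n] at which the
   functionals chosen so far are small on [v n], then a block [n, m] that
   carries most of [S n (v n)], and a functional that norms it. *)
have step (st : seq (dual Z) * nat) : exists r : nat * nat * dual Z * dual Z,
  let: (n, m, B, b) := r in
  [/\ (st.2 <= n)%N, (n <= m)%N &
    [/\ forall z, `|sval B z : R| <= `|z|,
        forall z, sval b z = sval B (D n m z) &
    [/\ forall f, List.In f st.1 -> `|sval f (v n) : R| <= e / 16 / (size st.1).+1%:R,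
        C * `|S m (v n)| <= e / 16 & e / 2 <= sval b (v n) ]]].
  have [n nN Hn] := Hw st.1 (e / 16 / (size st.1).+1%:R) (maxn st.2 N0)
    (divr_gt0 (divr_gt0 e0 (ltr0Sn _ _)) (ltr0Sn _ _)).
  move: nN; rewrite geq_max => /andP[ln Nn].
  have [N1 H1] := @tail_cvg0 (v n) (e / 16 / C) (divr_gt0 (divr_gt0 e0 (ltr0Sn _ _)) C0).
  have [N2 H2] := @block_cvg_tail n (v n) (e / 4) (divr_gt0 e0 (ltr0Sn _ _)).
  pose m := maxn n (maxn N1 N2).
  have [nm [m1 m2]] : (n <= m)%N /\ (N1 <= m)%N /\ (N2 <= m)%N.
    by rewrite /m !leq_max !leqnn !orbT.
  have [B [B1 BD]] := norming_functional (D n m (v n)).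
  have [||b Hb] := @dual_of_bounded _ Z (fun z => sval B (D n m z)) 4.
      by move=> a x y; rewrite !linearP.
    by move=> z; exact: le_trans (B1 _) (D_le _ _ _).
  exists (n, m, B, b); split=> //; split=> //; split.
  - by move=> f /Hn; rewrite /v linearB => /ltW.
  - by move: (H1 m m1); rewrite ltr_pdivlMr// mulrC => /ltW.
  rewrite Hb BD.
  have := H2 m m2; have := Sv n Nn.
  by have := ler_normD (S n (v n) - D n m (v n)) (D n m (v n)); rewrite subrK; lra.
have [F HF] := choice step.
pose next (st : seq (dual Z) * nat) :=
  let: (n, m, B, b) := F st in (b :: st.1, m).
pose st i := iter i next ([::], 0%N).
pose n i := (F (st i)).1.1.1; pose m i := (F (st i)).1.1.2.
pose B i := (F (st i)).1.2; pose b i := (F (st i)).2.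
have stS i : st i.+1 = (b i :: (st i).1, m i).
  by rewrite /st iterS /next /b /m -/(st i); case: (F (st i)) => [[[]]].
have Hst i : [/\ ((st i).2 <= n i)%N, (n i <= m i)%N &
    [/\ forall z, `|sval (B i) z : R| <= `|z|,
        forall z, sval (b i) z = sval (B i) (D (n i) (m i) z) &
    [/\ forall f, List.In f (st i).1 -> `|sval f (v (n i)) : R| <= e / 16 / (size (st i).1).+1%:R,
        C * `|S (m i) (v (n i))| <= e / 16 & e / 2 <= sval (b i) (v (n i)) ]]].
  by have := HF (st i); rewrite /n /m /B /b; case: (F (st i)) => [[[]]].
have nm i : (n i <= m i)%N by case: (Hst i).
have mn i : (m i <= n i.+1)%N by case: (Hst i.+1); rewrite stS.
have mn_lt i j : (i < j)%N -> (m i <= n j)%N.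
  elim: j => // j IH; rewrite ltnS leq_eqVlt => /predU1P[->//|/IH h].
  exact: leq_trans h (leq_trans (nm j) (mn j)).
have size_st i : size (st i).1 = i.
  by elim: i => // i IH; rewrite stS /= IH.
have in_st i j : (i < j)%N -> List.In (b i) (st j).1.
  elim: j => // j IH; rewrite ltnS leq_eqVlt stS => /predU1P[->|/IH h]; first by left.
  by right.
have bE i z : sval (b i) z = sval (B i) (D (n i) (m i) z) by case: (Hst i) => _ _ [].
have B1 i z : `|sval (B i) z : R| <= `|z| by case: (Hst i) => _ _ [].
have b_early i j : (i < j)%N -> `|sval (b i) (v (n j)) : R| <= e / 16 / j.+1%:R.
  by move=> ij; case: (Hst j) => _ _ [_ _ [/(_ _ (in_st _ _ ij)) + _ _]]; rewrite size_st.
have bC N z : \sum_(0 <= i < N) `|sval (b i) z : R| <= C * `|z|.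
  under eq_bigr do rewrite bE; exact: sum_blocks_le.
have [theta theta_cvg theta_tail] := dual_series bC.
have theta_v j : e / 4 <= `|sval theta (v (n j)) : R|.
  have [_ _ [_ _ [_ Sm bj]]] := Hst j.
  have t1 : `|sval theta (v (n j)) - \sum_(0 <= i < j.+1) (sval (b i) (v (n j)) : R)| <= e / 16.
    apply: theta_tail => M; apply: le_trans Sm.
    apply: le_trans (bC M _).
    have [jM|Mj] := leqP j.+1 M; last first.
      by rewrite big_geq ?sumr_ge0// ltnW.
    rewrite [leRHS](@big_cat_nat _ _ _ j.+1)//= -[leLHS]add0r lerD ?sumr_ge0//.
    rewrite !big_nat; apply: ler_sum => i /andP[ji _].
    by rewrite !bE block_tail// mn_lt.
  have t2 : `|\sum_(0 <= i < j) (sval (b i) (v (n j)) : R)| <= e / 16.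
    apply: (le_trans (ler_norm_sum _ _ _)).
    apply: (@le_trans _ _ (\sum_(0 <= i < j) (e / 16 / j.+1%:R))).
      by rewrite !big_nat; apply: ler_sum => i /andP[_ ij]; exact: b_early.
    rewrite big_const_nat iter_addr addr0 subn0 -[leLHS]mulr_natr.
    by rewrite mulrAC ler_pdivrMr// ler_pM2l ?divr_gt0// ler_nat.
  move: t1; rewrite big_nat_recr//=.
  move: t2; rewrite !ler_norml => /andP[? ?] /andP[? ?].
  by rewrite ler_normr; apply/orP; left; lra.
have [w' Kw' Hw'] := weak_cluster Kc (fun j => (Hu (n j)).1).
have b0 i : sval (b i) (w' - w) = 0 :> R.
  suff small (d : R) : 0 < d -> `|(sval (b i) (w' - w) : R)| <= d.
    apply/eqP; rewrite -normr_le0; apply/ler_addgt0Pr => d d0; rewrite add0r.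
    exact: small.
  move=> d0; have d20 : 0 < d / 2 by rewrite divr_gt0.
  have [N _ HN] := near_infty_natSinv_lt (PosNum (divr_gt0 d20 (divr_gt0 e0 (ltr0Sn R 15)))).
  have [j] := Hw' [:: b i] (d / 2) (maxn N i.+1) d20.
  rewrite geq_max => /andP[Nj ij] /(_ _ (or_introl erefl)) h1.
  have h2 := b_early _ _ ij.
  have h3 : e / 16 / j.+1%:R < d / 2.
    by rewrite mulrC -ltr_pdivlMr ?divr_gt0//; exact: HN.
  pose x : R := sval (b i) (v (n j)).
  pose y : R := sval (b i) (u (n j)) - sval (b i) w'.
  have E : sval (b i) (w' - w) = x - y :> R.
    by rewrite /x /y /v !linearB /=; ring.
  have h1' : `|y| < d / 2 := h1; have h2' : `|x| <= e / 16 / j.+1%:R := h2.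
  rewrite E (le_trans (ler_normB x y))// [d]splitr lerD//; last exact: ltW.
  exact: le_trans h2' (ltW h3).
have th0 : sval theta (w' - w) = 0 :> R.
  have := theta_cvg (w' - w); rewrite (_ : series _ = cst 0).
    by move=> h; rewrite -[LHS](cvg_lim _ h)// lim_cst.
  by apply/funext => N; rewrite /series /= big1.
have [j _] := Hw' [:: theta] (e / 8) 0%N (divr_gt0 e0 (ltr0Sn _ _)).
move=> /(_ _ (or_introl erefl)) h.
have h' : `|(sval theta (u (n j)) - sval theta w' : R)| < e / 8 := h.
have := theta_v j.
have -> : sval theta (v (n j)) = sval theta (u (n j)) - sval theta w' :> R.
  by move: th0; rewrite /v !linearB /= => th0; lra.
by move=> h2; have := le_lt_trans h2 h'; lra.
Qed.

End Tails.

(** * The absorbing set *)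

Section CompactPieces.
Context (R : realType) (X Y : normedModType R).
Context (P : finite_rank_approximation X) (Q : finite_rank_approximation Y).
Context (c : R) (c_gt0 : 0 < c).
Hypothesis X_convex : two_convex c (fun x : X => `|x| ^+ 2).
Hypothesis Y_convex : two_convex c (fun y : Y => `|y| ^+ 2).
Local Notation Z := (projective_tensor X Y).
Context (S : nat -> {linear Z -> Z}).
Hypothesis S_tens : forall n x y, S n (tens x y) = tens (x - P n x) (y - Q n y).
Hypothesis S_le : forall n z, `|S n z| <= 4 * `|z|.

(** The operator [T] from Y^d1 x X^d2, sending a pair of families to the tensors
    with the fixed vectors [e1], [e2], has a range whose closure contains every
    [z - S n z]; a bound on [z] bounds the coordinates because the projective
    norm controls sums of |x| |y|.  The factor [r] brings the image of the ball
    into the ball of radius 1/(n + 1). *)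
Lemma compact_piece n : exists G : set Z, [/\ weakly_compact G,
  forall g, G g -> `|g| <= n.+1%:R^-1 &
  forall M : R, exists k : nat, forall z, `|z| <= M ->
    exists2 g, G g & z - S n z = k%:R *: g].
Proof.
have [d1 [e1 [a1 [Pe [C1 C10 a1C]]]]] := proj_coord P n.
have [d2 [e2 [a2 [Qe [C2 C20 a2C]]]]] := proj_coord Q n.
pose W := ({ffun 'I_d1 -> Y} * {ffun 'I_d2 -> X})%type.
pose q (w : W) : R := \sum_i `|w.1 i| ^+ 2 + \sum_j `|w.2 j| ^+ 2.
pose A : R := \sum_i `|e1 i| + \sum_j `|e2 j| + 1.
have A0 : 0 < A by rewrite ltr_wpDl// addr_ge0// sumr_ge0.
pose r : R := n.+1%:R^-1 / A.
have r0 : 0 < r by rewrite divr_gt0// invr_gt0.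
pose T0 (w : W) : Z := \sum_i tens (e1 i) (w.1 i) + \sum_j tens (w.2 j) (e2 j).
have T0lin : linear (fun w => r *: T0 w : Z).
  move=> k v w; have -> : T0 (k *: v + w) = k *: T0 v + T0 w; last first.
    by rewrite scalerDr !scalerA mulrC.
  rewrite /T0 scalerDr addrACA !scaler_sumr -!big_split /=.
  congr (_ + _); apply: eq_bigr => i _.
    by rewrite !ffunE -(tens_bilinear _ _).2.
  by rewrite !ffunE -(tens_bilinear _ _).1.
pose L := GRing.isLinear.Build R W Z _ _ T0lin.
pose T : {linear W -> Z} := HB.pack (fun w => r *: T0 w : Z) L.
have q0 w : 0 <= q w by rewrite addr_ge0// sumr_ge0// => i _; rewrite exprn_ge0.
have qconv : two_convex c q.
  move=> v w; rewrite /q.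
  have h1 : \sum_i (`|2^-1 *: (v.1 i + w.1 i)| ^+ 2 + c * `|2^-1 *: (v.1 i - w.1 i)| ^+ 2)
      <= \sum_i ((`|v.1 i| ^+ 2 + `|w.1 i| ^+ 2) / 2) by apply: ler_sum => i _; exact: Y_convex.
  have h2 : \sum_i (`|2^-1 *: (v.2 i + w.2 i)| ^+ 2 + c * `|2^-1 *: (v.2 i - w.2 i)| ^+ 2)
      <= \sum_i ((`|v.2 i| ^+ 2 + `|w.2 i| ^+ 2) / 2) by apply: ler_sum => i _; exact: X_convex.
  move: h1 h2; rewrite -!mulr_suml !big_split /= -!mulr_sumr.
  have E1 : \sum_i `|(2^-1 *: (v + w)).1 i| ^+ 2 = \sum_i `|2^-1 *: (v.1 i + w.1 i)| ^+ 2.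
    by apply: eq_bigr => i _; rewrite !ffunE.
  have E2 : \sum_i `|(2^-1 *: (v + w)).2 i| ^+ 2 = \sum_i `|2^-1 *: (v.2 i + w.2 i)| ^+ 2.
    by apply: eq_bigr => i _; rewrite !ffunE.
  have E3 : \sum_i `|(2^-1 *: (v - w)).1 i| ^+ 2 = \sum_i `|2^-1 *: (v.1 i - w.1 i)| ^+ 2.
    by apply: eq_bigr => i _; rewrite !ffunE.
  have E4 : \sum_i `|(2^-1 *: (v - w)).2 i| ^+ 2 = \sum_i `|2^-1 *: (v.2 i - w.2 i)| ^+ 2.
    by apply: eq_bigr => i _; rewrite !ffunE.
  rewrite E1 E2 E3 E4; lra.
have T0_le w : `|T0 w| <= A * Num.sqrt (q w).
  have le1 i : `|w.1 i| <= Num.sqrt (q w).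
    rewrite -[leLHS]ger0_norm// -sqrtr_sqr ler_wsqrtr// /q (bigD1 i)//= -addrA.
    by rewrite lerDl addr_ge0// sumr_ge0// => *; rewrite exprn_ge0.
  have le2 i : `|w.2 i| <= Num.sqrt (q w).
    rewrite -[leLHS]ger0_norm// -sqrtr_sqr ler_wsqrtr// /q [X in _ + X](bigD1 i)//= addrCA.
    by rewrite lerDl addr_ge0// sumr_ge0// => *; rewrite exprn_ge0.
  rewrite /A !mulrDl mul1r (le_trans (ler_normD _ _))//.
  apply: (@le_trans _ _ ((\sum_i `|e1 i|) * Num.sqrt (q w) +
     (\sum_j `|e2 j|) * Num.sqrt (q w))); last by rewrite lerDl sqrtr_ge0.
  rewrite lerD// (le_trans (ler_norm_sum _ _ _))// mulr_suml ler_sum// => i _.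
    by rewrite (le_trans (norm_tens _ _))// ler_wpM2l.
  by rewrite (le_trans (norm_tens _ _))// mulrC ler_wpM2l.
have T_le w : `|T w| <= n.+1%:R^-1 * Num.sqrt (q w).
  rewrite /= normrZ gtr0_norm// /r -mulrA ler_wpM2l ?invr_ge0//.
  by rewrite ler_pdivrMl.
have n1 : n.+1%:R^-1 <= 1 :> R by rewrite invf_le1// ler1n.
have Tsq w : `|T w| ^+ 2 <= q w.
  rewrite -[leRHS]sqr_sqrtr// ler_pXn2r ?nnegrE ?sqrtr_ge0//.
  by rewrite (le_trans (T_le w))// ler_piMl ?sqrtr_ge0.
exists (ball_image q T); split.
- exact: weakly_compact_ball_image c_gt0 q0 qconv Tsq.
- move=> g Hg; apply/ler_addgt0Pr => e e0; have [w w1 gw] := Hg e e0.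
  have := ler_normD (g - T w) (T w); rewrite subrK => /le_trans; apply.
  rewrite addrC lerD//; last exact: ltW.
  rewrite (le_trans (T_le w))// ler_piMr ?invr_ge0//.
  by rewrite -sqrtr1 ler_wsqrtr.
move=> M.
pose C : R := \sum_(i < d1) (C1 * (`|M| + 1)) ^+ 2 + \sum_(j < d2) (2 * C2 * (`|M| + 1)) ^+ 2.
have C0 : 0 <= C by rewrite addr_ge0// sumr_ge0// => i _; rewrite sqr_ge0.
(* [C] bounds [q] at the coordinates of a representation of [z], and [k * r],
   being at least [C + 1], has a square of at least [C]. *)
pose k := (Num.trunc ((C + 1) / r)).+1.
have k0 : 0 < k%:R :> R by rewrite ltr0n.
have kr : C + 1 <= k%:R * r by rewrite -ler_pdivrMr// ltW// truncnS_gt.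
exists k => z zM; exists (k%:R^-1 *: (z - S n z)); last first.
  by rewrite scalerA divff ?scale1r// gt_eqF.
move=> e e0.
have e'0 : 0 < Num.min 1 (e / 6) by rewrite lt_min ltr01 divr_gt0.
have [s + sM] := tens_dense z e'0; rewrite lt_min => /andP[zs1 zse].
have {}sM : tens_cost s <= `|M| + 1.
  rewrite (le_trans (ltW sM))// lerD// ?ge_min ?lexx//.
  by rewrite (le_trans zM)// ler_norm.
pose w : W := ([ffun i => \sum_(t <- s) (a1 i t.1 : R) *: t.2],
               [ffun j => \sum_(t <- s) (a2 j t.2 : R) *: (t.1 - P n t.1)]).
have T0w : T0 w = tens_sum s - S n (tens_sum s).
  have zl (x : X) (I : Type) (l : seq I) (F : I -> Y) :
      tens x (\sum_(i <- l) F i) = \sum_(i <- l) tens x (F i).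
    elim: l => [|i l IH].
      by rewrite !big_nil -(scale0r 0) (bilinear_forZr (@tens_bilinear _ X Y)) scale0r.
    by rewrite !big_cons (bilinear_forDr (@tens_bilinear _ X Y)) IH.
  have zr (y : Y) (I : Type) (l : seq I) (F : I -> X) :
      tens (\sum_(i <- l) F i) y = \sum_(i <- l) tens (F i) y.
    elim: l => [|i l IH].
      by rewrite !big_nil -(scale0r 0) (bilinear_forZl (@tens_bilinear _ X Y)) scale0r.
    by rewrite !big_cons (bilinear_forDl (@tens_bilinear _ X Y)) IH.
  rewrite /T0 /w /=.
  under eq_bigr do rewrite ffunE zl.
  under [X in _ + X]eq_bigr do rewrite ffunE zr.
  rewrite exchange_big /= [X in _ + X]exchange_big /= -big_split /=.
  rewrite /tens_sum linear_sum -sumrB; apply: eq_bigr => -[x y] _ /=.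
  rewrite S_tens.
  have -> : \sum_i tens (e1 i) (a1 i x *: y) = tens (P n x) y.
    rewrite Pe zr; apply: eq_bigr => i _.
    by rewrite (bilinear_forZr (@tens_bilinear _ X Y)) (bilinear_forZl (@tens_bilinear _ X Y)).
  have -> : \sum_j tens (a2 j y *: (x - P n x)) (e2 j) = tens (x - P n x) (Q n y).
    rewrite Qe zl; apply: eq_bigr => i _.
    by rewrite (bilinear_forZr (@tens_bilinear _ X Y)) (bilinear_forZl (@tens_bilinear _ X Y)).
  have {1}-> : tens x y = tens (P n x) y +
      (tens (x - P n x) (Q n y) + tens (x - P n x) (y - Q n y)).
    rewrite -(bilinear_forDr (@tens_bilinear _ X Y)) subrKC.
    by rewrite -(bilinear_forDl (@tens_bilinear _ X Y)) subrKC.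
  by rewrite addrA addrK.
have wC : q w <= C.
  have cost_ge0 : 0 <= tens_cost s by rewrite sumr_ge0// => t _; rewrite mulr_ge0.
  have hC1 : 0 <= C1 * (`|M| + 1) by rewrite mulr_ge0// ltW.
  have hC2 : 0 <= 2 * C2 * (`|M| + 1) by rewrite !mulr_ge0// ltW.
  rewrite /q /C lerD//; apply: ler_sum => i _; rewrite ler_pXn2r ?nnegrE//.
    rewrite ffunE (le_trans (ler_norm_sum _ _ _))//.
    apply: (@le_trans _ _ (C1 * tens_cost s)); last by rewrite ler_wpM2l// ltW.
    rewrite /tens_cost mulr_sumr; apply: ler_sum => t _.
    by rewrite normrZ mulrA ler_wpM2r// a1C.
  rewrite ffunE (le_trans (ler_norm_sum _ _ _))//.
  apply: (@le_trans _ _ (2 * C2 * tens_cost s)); last by rewrite ler_wpM2l// mulr_ge0// ltW.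
  rewrite /tens_cost mulr_sumr; apply: ler_sum => t _.
  rewrite normrZ; have -> : 2 * C2 * (`|t.1| * `|t.2|) = C2 * `|t.2| * (2 * `|t.1|) by ring.
  by rewrite ler_pM// ?a2C// norm_coproj.
exists ((k%:R * r)^-1 *: w).
  have kr0 : 0 < k%:R * r by rewrite mulr_gt0.
  have -> : q ((k%:R * r)^-1 *: w) = (k%:R * r)^-1 ^+ 2 * q w.
    by rewrite /q mulrDr !mulr_sumr; congr (_ + _); apply: eq_bigr => i _;
      rewrite ffunE normrZ exprMn gtr0_norm// invr_gt0.
  rewrite exprVn ler_pdivrMl ?exprn_gt0// mulr1 (le_trans wC)//.
  apply: (@le_trans _ _ (k%:R * r)); first by rewrite (le_trans _ kr)// lerDl.
  by rewrite -[leLHS]mulr1 expr2 ler_pM2l// (le_trans _ kr)// lerDr.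
rewrite (linearZ_LR T) -[T w]/(r *: T0 w) T0w scalerA.
have -> : (k%:R * r)^-1 * r = k%:R^-1 by field; rewrite !gt_eqF.
rewrite -scalerBr normrZ gtr0_norm ?invr_gt0//.
have -> : z - S n z - (tens_sum s - S n (tens_sum s)) =
    (z - tens_sum s) - S n (z - tens_sum s).
  by rewrite (linearB (S n)) !opprD !opprK addrACA.
apply: (@le_lt_trans _ _ (5 * `|z - tens_sum s|)).
  apply: (@le_trans _ _ (1 * `|z - tens_sum s - S n (z - tens_sum s)|)).
    by rewrite ler_wpM2r// invf_le1// ler1n.
  rewrite mul1r (le_trans (ler_normB _ _))//.
  by have := S_le n (z - tens_sum s); lra.
lra.
Qed.

End CompactPieces.

Theorem SWCG_projective_tensor (R : realType) (X Y : normedModType R)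
    (P : finite_rank_approximation X) (Q : finite_rank_approximation Y) (c : R) : 0 < c ->
  two_convex c (fun x : X => `|x| ^+ 2) -> two_convex c (fun y : Y => `|y| ^+ 2) ->
  SWCG (projective_tensor X Y).
Proof.
move=> c0 Xc Yc.
have [S [S_tens S_le]] := tail_operators P Q.
have [D [D_tens D_le]] := block_operators P Q.
have [G HG] := choice (compact_piece c0 Xc Yc S_tens S_le).
exists ([set 0] `|` \bigcup_n G n).
  by apply: weakly_compact_null_union => n; case: (HG n).
move=> K Kc e e0.
have [n Hn] := weakly_compact_tail c0 Xc Yc S_tens S_le D_tens D_le Kc e0.
have [M HM] := weakly_compact_bounded Kc.
have [_ _ /(_ M) [k Hk]] := HG n.
exists k => z Kz; have [g Gg zg] := Hk z (HM z Kz).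
exists g; first by right; exists n.
exists (e^-1 *: S n z).
  rewrite /unit_ball /= normrZ gtr0_norm ?invr_gt0// ler_pdivrMl// mulr1.
  exact: Hn.
by rewrite scalerA divff ?gt_eqF// scale1r -zg subrK.
Qed.

(** * Inequalities between powers *)

Section PowerInequalities.
Context (R : realType).
Implicit Types (a b s t x y p r : R).

Lemma concave_powR r s t x y : 0 < r -> r <= 1 -> 0 <= s -> 0 <= t -> s + t = 1 ->
  0 <= x -> 0 <= y -> s * x `^ r + t * y `^ r <= (s * x + t * y) `^ r.
Proof.
move=> r0 r1 s0 t0 st x0 y0.
have s1 : s <= 1 by lra.
pose i := Itv01 s0 s1.
have q1 : 1 <= r^-1 by rewrite invf_ge1.
have h := @convex_powR R r^-1 q1 i (x `^ r) (y `^ r).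
rewrite !inE /= !in_itv /= !andbT in h.
have {h} := h (powR_ge0 _ _) (powR_ge0 _ _).
rewrite convRE [X in X `^ _ <= _]convRE /= -!powRrM !mulfV ?gt_eqF// !powRr1// /unstable.onem.
have -> : 1 - s = t by lra.
move=> h.
have A0 : 0 <= s * x `^ r + t * y `^ r by rewrite addr_ge0// mulr_ge0// powR_ge0.
have rn0 : r != 0 by rewrite gt_eqF.
rewrite -[leLHS](powRr1 A0) -(mulVf rn0) powRrM.
by apply: ge0_ler_powR; rewrite ?nnegrE ?powR_ge0 ?(ltW r0) ?addr_ge0 ?mulr_ge0.
Qed.

(** For given x and y the supremum of the left-hand side over s + t = 1 is
    the right-hand side.  This writes a concave power of a sum as a supremum of
    combinations of powers, which can be integrated term by term. *)
Lemma powR_split r s t x y : 0 < r -> r <= 1 -> 0 < s -> 0 < t -> s + t = 1 ->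
  0 <= x -> 0 <= y ->
  s `^ (1 - r) * x `^ r + t `^ (1 - r) * y `^ r <= (x + y) `^ r.
Proof.
move=> r0 r1 s0 t0 st x0 y0.
have := concave_powR r0 r1 (ltW s0) (ltW t0) st (divr_ge0 x0 (ltW s0)) (divr_ge0 y0 (ltW t0)).
have E (u z : R) : 0 < u -> 0 <= z -> u * (z / u) `^ r = u `^ (1 - r) * z `^ r.
  move=> u0 z0; rewrite powRM ?invr_ge0 ?(ltW u0)// -(powR_inv1 (ltW u0)) -powRrM.
  rewrite mulrCA mulrC; congr (_ * _).
  rewrite -{1}(powRr1 (ltW u0)) -powRD ?mulN1r//.
  by apply/implyP => _; rewrite gt_eqF.
rewrite !E//; congr (_ <= (_ + _) `^ _); by rewrite mulrC divfK// gt_eqF.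
Qed.

(** A quarter of the slope of the chord of x |-> (1 + x)^(p - 1) over [0, 1],
    which is what the derivative in [two_point_unit] can afford. *)
Definition two_point_cst p : R := (2 `^ (p - 1) - 1) / 4.

Lemma two_point_cst_gt0 p : 1 < p -> 0 < two_point_cst p.
Proof.
move=> p1; rewrite divr_gt0// subr_gt0 -[ltLHS](powRr0 (2 : R)).
by rewrite /powR pnatr_eq0 /= ltr_expR ltr_pM2r ?subr_gt0// ln_gt0// ltr1n.
Qed.

Lemma two_point_cst_le1 p : p <= 2 -> two_point_cst p <= 1.
Proof.
move=> p2; have : 2 `^ (p - 1) <= 2 `^ 1 :> R by rewrite ler_powR ?ler1n//; lra.
by rewrite powRr1// /two_point_cst; lra.
Qed.

(** Twice the difference of the two sides vanishes at 0 and is nondecreasing: by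
    concavity, the graph of (1 + x)^(p - 1) lies above its chord over [0, 1]. *)
Lemma two_point_unit p t : 1 < p -> p <= 2 -> 0 <= t -> t <= 1 ->
  1 + two_point_cst p * t ^+ 2 <= ((1 + t) `^ p + (1 - t) `^ p) / 2.
Proof.
move=> p1 p2 t0; have c0 := two_point_cst_gt0 p1.
rewrite le_eqVlt => /predU1P[->|t1].
  rewrite subrr powR0 ?gt_eqF ?(lt_trans ltr01)// addr0 expr1n mulr1.
  have -> : (1 + 1) `^ p = 2 * 2 `^ (p - 1) :> R.
    by rewrite mulr_powRB1// (lt_trans ltr01).
  by rewrite /two_point_cst in c0 *; lra.
pose c := two_point_cst p; rewrite -/c in c0 *.
pose phi (x : R) : R := (1 + x) `^ p + (1 - x) `^ p - 2 * c * x ^+ 2.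
pose dphi (x : R) : R := p * (1 + x) `^ (p - 1) - p * (1 - x) `^ (p - 1) - 4 * c * x.
have dphiP x : -1 < x -> x < 1 -> is_derive x 1 phi (dphi x).
  move=> x0 x1.
  have h1 : is_derive (1 + x) 1 (@powR R ^~ p) (p * (1 + x) `^ (p - 1)).
    by apply: is_derive1_powR; lra.
  have h2 : is_derive (1 - x) 1 (@powR R ^~ p) (p * (1 - x) `^ (p - 1)).
    by apply: is_derive1_powR; lra.
  have g1 : is_derive x 1 ((cst 1 : R -> R) + id) (0 + 1) by exact: is_deriveD.
  have g2 : is_derive x 1 ((cst 1 : R -> R) - id) (0 - 1) by exact: is_deriveB.
  have k := is_deriveD (@is_derive1_comp _ _ _ x _ _ h1 g1)
    (@is_derive1_comp _ _ ((cst 1 : R -> R) - id) x _ _ h2 g2).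
  have k2 : is_derive x 1 ((2 * c) \*: ((id : R -> R) ^+ 2))
      ((2 * c) *: ((2%:R * id x ^+ 2.-1) *: 1)).
    by apply: is_deriveZ.
  have K : is_derive x 1 phi _ := is_deriveB k k2.
  apply: (is_derive_eq K).
  by rewrite /dphi /GRing.scale /=; ring.
have phi_mono : phi 0 <= phi t.
  apply: (@ger0_derive1_le_cc _ phi 0 t) => //.
  - move=> x; rewrite in_itv /= => /andP[x0 xt].
    have h : is_derive x 1 phi (dphi x) by apply: dphiP; lra.
    exact: ex_derive.
  - move=> x; rewrite in_itv /= => /andP[x0 xt].
    have h : is_derive x 1 phi (dphi x) by apply: dphiP; lra.
    rewrite derive1E derive_val /dphi.
    have r0 : 0 < p - 1 by lra.
    have r1 : p - 1 <= 1 by lra.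
    have := @concave_powR (p - 1) (1 - x) x 1 2 r0 r1.
    have -> : (1 - x) * 1 + x * 2 = 1 + x by ring.
    rewrite powR1 mulr1 => h3.
    have {}h3 : (1 - x) + x * 2 `^ (p - 1) <= (1 + x) `^ (p - 1) by apply: h3; lra.
    have h4 : (1 - x) `^ (p - 1) <= 1.
      have a1 : 0 < 1 - x <= 1 by apply/andP; split; lra.
      by have := ger_powR a1 (ltW r0); rewrite powRr0.
    have h5 : 4 * c * x = (2 `^ (p - 1) - 1) * x by rewrite /c /two_point_cst; field.
    rewrite h5 -mulrBr.
    have h6 : (2 `^ (p - 1) - 1) * x <= (1 + x) `^ (p - 1) - (1 - x) `^ (p - 1) by lra.
    have h7 : 0 <= (2 `^ (p - 1) - 1) * x.
      by rewrite mulr_ge0 ?(ltW x0)//; move: c0; rewrite /c /two_point_cst; lra.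
    rewrite subr_ge0 (le_trans h6)// ler_peMl//; lra.
  - apply: derivable_within_continuous => x; rewrite in_itv /= => /andP[x0 xt].
    have h : is_derive x 1 phi (dphi x) by apply: dphiP; lra.
    exact: ex_derive.
  - by rewrite in_itv /= lexx.
  - by rewrite in_itv /= t0 lexx.
move: phi_mono; rewrite /phi /= addr0 subr0 powR1 expr0n /= mulr0 subr0; lra.
Qed.

Let two_point_pos p a b : 1 < p -> p <= 2 -> 0 <= b -> b <= a ->
  (a ^+ 2 + two_point_cst p * b ^+ 2) `^ (p / 2) <=
  ((a + b) `^ p + (a - b) `^ p) / 2.
Proof.
move=> p1 p2 b0 ba; have c0 := two_point_cst_gt0 p1.
have p0 : 0 < p by lra.
have [a0|a0] := eqVneq a 0.
  have -> : b = 0 by apply/eqP; rewrite eq_le b0 andbT -a0.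
  by rewrite a0 expr0n /= mulr0 addr0 powR0 ?gt_eqF ?divr_gt0.
have {}a0 : 0 < a by rewrite lt_neqAle eq_sym a0 (le_trans b0).
pose t := b / a.
have t0 : 0 <= t by rewrite divr_ge0// ltW.
have t1 : t <= 1 by rewrite ler_pdivrMr// mul1r.
have -> : a ^+ 2 + two_point_cst p * b ^+ 2 = a ^+ 2 * (1 + two_point_cst p * t ^+ 2).
  by rewrite /t; field; lra.
have -> : a + b = a * (1 + t) by rewrite /t; field; lra.
have -> : a - b = a * (1 - t) by rewrite /t; field; lra.
clearbody t; have a0' := ltW a0.
have ct0 : 0 <= 1 + two_point_cst p * t ^+ 2.
  by rewrite addr_ge0// mulr_ge0 ?sqr_ge0// ltW.
rewrite (powRM _ (sqr_ge0 a) ct0) (powRM _ a0' (addr_ge0 ler01 t0)) powRM ?subr_ge0//.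
rewrite -mulrDr -[a ^+ 2](powR_mulrn 2 (ltW a0)) -powRrM mulrCA mulfV// mulr1.
rewrite -mulrA ler_pM2l ?powR_gt0//.
apply: le_trans (two_point_unit p1 p2 t0 t1).
apply: ler1_powR; last lra.
by rewrite lerDl mulr_ge0 ?sqr_ge0// ltW.
Qed.

Lemma two_point p a b : 1 < p -> p <= 2 ->
  (a ^+ 2 + two_point_cst p * b ^+ 2) `^ (p / 2) <=
  (`|a + b| `^ p + `|a - b| `^ p) / 2.
Proof.
move=> p1 p2; have c0 := two_point_cst_gt0 p1; have c1 := two_point_cst_le1 p2.
have -> : `|a + b| `^ p + `|a - b| `^ p =
    `|(`|a| + `|b|)| `^ p + `|(`|a| - `|b|)| `^ p.
  have [a0|a0] := leP 0 a; have [b0|b0] := leP 0 b.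
  - by rewrite (ger0_norm a0) (ger0_norm b0).
  - by rewrite (ger0_norm a0) (ltr0_norm b0) opprK addrC.
  - rewrite (ltr0_norm a0) (ger0_norm b0).
    by rewrite -(normrN (- a + b)) -(normrN (- a - b)) !opprD !opprK addrC.
  - rewrite (ltr0_norm a0) (ltr0_norm b0).
    by rewrite -(normrN (- a + - b)) -(normrN (- a - - b)) !opprD !opprK.
have sqr_norm x : x ^+ 2 = `|x| ^+ 2 by rewrite real_normK ?num_real.
rewrite (sqr_norm a) (sqr_norm b) {sqr_norm}.
move: (normr_ge0 a) (normr_ge0 b); move: `|a| `|b| => {}a {}b a0 b0.
have [ba|ab] := leP b a.
  by rewrite !ger0_norm ?subr_ge0 ?addr_ge0//; exact: two_point_pos.
rewrite (addrC a) (distrC a) !ger0_norm ?subr_ge0 ?addr_ge0// ?(ltW ab)//.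
apply: le_trans (two_point_pos p1 p2 a0 (ltW ab)).
have h : a ^+ 2 <= b ^+ 2 by rewrite ler_pXn2r ?nnegrE// ltW.
have nonneg x y : 0 <= x ^+ 2 + two_point_cst p * y ^+ 2.
  by rewrite addr_ge0 ?sqr_ge0// mulr_ge0 ?sqr_ge0 ?(ltW c0).
apply: ge0_ler_powR; rewrite ?nnegrE//; first lra.
have : 0 <= (1 - two_point_cst p) * (b ^+ 2 - a ^+ 2).
  by rewrite mulr_ge0// subr_ge0.
lra.
Qed.

End PowerInequalities.

(** * Uniform convexity of L_p *)

Section LpConvexity.
Context d (T : measurableType d) (R : realType) (mu : {measure set T -> \bar R}).
Context (p : R) (p1 : (1 <= p%:E)%E).
Local Notation Lp := (LspaceType mu p1 : normedModType R).
Local Notation Lf := (LfunType mu p1).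

Let p0 : 0 < p. Proof. by move: p1; rewrite lee_fin; exact: lt_le_trans. Qed.

Lemma Lp_norm_powR (f : Lf) :
  (`|Lp_class f : Lp| `^ p)%:E = (\int[mu]_t (`|f t| `^ p)%:E)%E.
Proof.
rewrite -[X in (X `^ p)%:E]/(Lp_norm _) Lp_norm_class -poweR_EFin finite_norm_fine.
by rewrite powR_Lnorm// gt_eqF.
Qed.

Lemma measurable_Lf_powR (f : Lf) :
  measurable_fun [set: T] ((fun t => (`|f t| `^ p)%:E) : T -> \bar R).
Proof.
apply/measurable_EFinP; apply: (measurableT_comp (measurable_powR _)) => //.
by apply: measurableT_comp => //; exact: (@measurable_funPT _ _ _ _ f).
Qed.

Lemma Lp_norm_powR_le (f1 f2 g1 g2 : Lf) (a b : R) : 0 <= a -> 0 <= b ->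
  (forall t, a * `|f1 t| `^ p + b * `|f2 t| `^ p <= `|g1 t| `^ p + `|g2 t| `^ p) ->
  a * `|Lp_class f1 : Lp| `^ p + b * `|Lp_class f2 : Lp| `^ p <=
  `|Lp_class g1 : Lp| `^ p + `|Lp_class g2 : Lp| `^ p.
Proof.
move=> a0 b0 H.
have m := measurable_Lf_powR.
rewrite -lee_fin 2!EFinD 2!EFinM !Lp_norm_powR.
rewrite -!ge0_integralZl//; try (by move=> t _; rewrite lee_fin powR_ge0).
rewrite -!ge0_integralD//; try (by move=> t _; rewrite ?mule_ge0// lee_fin powR_ge0);
  try (by apply: measurable_funeM).
apply: ge0_le_integral => //.
- by move=> t _; rewrite -!EFinM -EFinD lee_fin addr_ge0// mulr_ge0// powR_ge0.
- by apply: emeasurable_funD; apply: measurable_funeM.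
- by apply: emeasurable_funD.
- by move=> t _; rewrite -!EFinM -!EFinD lee_fin.
Qed.

Hypotheses (p_gt1 : 1 < p) (p_le2 : p <= 2).

(** With a, b the half sum and half difference, and r = p/2 <= 1, the two-point
    inequality integrates to a bound of the integral of (|a|^2 + c |b|^2)^r by
    the mean of |a + b|^p and |a - b|^p.  That integral is bounded below by the
    r-th power of |a|^2 + c |b|^2 with norms in place of values, a reverse
    Minkowski inequality for the exponent r, obtained from [powR_split] with
    weights proportional to the squares of the norms.  The mean on the right is
    at most the r-th power of the mean of the squares, again by concavity. *)
Lemma Lp_two_convex : two_convex (two_point_cst p) (fun x : Lp => `|x| ^+ 2).
Proof.
pose c := two_point_cst p; have c0 : 0 < c := two_point_cst_gt0 p_gt1.
have c1 : c <= 1 := two_point_cst_le1 p_le2.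
pose r := p / 2; have r0 : 0 < r by rewrite divr_gt0.
have r1 : r <= 1 by rewrite ler_pdivrMr// mul1r.
have sq (x : Lp) : (`|x| ^+ 2) `^ r = `|x| `^ p.
  by rewrite -powR_mulrn// -powRrM /r mulrCA mulfV ?mulr1// pnatr_eq0.
have lift (k l : R) (a b : Lp) : 0 <= k -> 0 <= l ->
    (forall x y : R, k * `|x| `^ p + l * `|y| `^ p <= (`|x + y| `^ p + `|x - y| `^ p) / 2) ->
    k * `|a| `^ p + l * `|b| `^ p <= (`|a + b| `^ p + `|a - b| `^ p) / 2.
  move=> k0 l0 H; elim/Lp_ind: a => f; elim/Lp_ind: b => g.
  have -> : Lp_class f + Lp_class g = Lp_class (f + g) := Lp_add_class f g.
  have -> : Lp_class f - Lp_class g = Lp_class (f - g).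
    by rewrite -[- Lp_class g]/(Lp_opp _) Lp_opp_class; exact: Lp_add_class.
  rewrite ler_pdivlMr// mulrDl (mulrAC k) (mulrAC l).
  apply: Lp_norm_powR_le => [||t]; rewrite ?mulr_ge0//.
  by rewrite -(mulrAC k) -(mulrAC l) -mulrDl -ler_pdivlMr.
suff UC (a b : Lp) : `|a| ^+ 2 + c * `|b| ^+ 2 <= (`|a + b| ^+ 2 + `|a - b| ^+ 2) / 2.
  move=> v w; have := UC (2^-1 *: (v + w)) (2^-1 *: (v - w)).
  have half (x : Lp) : 2^-1 *: (x + x) = x.
    by rewrite -mulr2n -(scaler_nat 2 x) scalerA mulVf ?scale1r ?pnatr_eq0.
  have -> : 2^-1 *: (v + w) + 2^-1 *: (v - w) = v.
    by rewrite -scalerDr addrACA subrr addr0 half.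
  have -> // : 2^-1 *: (v + w) - 2^-1 *: (v - w) = w.
  by rewrite -scalerBr opprB [v + w]addrC addrACA subrr addr0 half.
have sum_le (x y : Lp) : (`|x| `^ p + `|y| `^ p) / 2 <=
    ((`|x| ^+ 2 + `|y| ^+ 2) / 2) `^ r.
  have h : 0 <= 2^-1 :> R by [].
  have := @concave_powR R r 2^-1 2^-1 (`|x| ^+ 2) (`|y| ^+ 2) r0 r1 h h.
  rewrite !sq -!mulrDr ![2^-1 * _]mulrC; apply; rewrite ?sqr_ge0//.
  by rewrite [RHS]splitr mul1r.
have [->|a0] := eqVneq a 0.
  rewrite add0r sub0r normrN normr0 expr0n /= add0r.
  by have : c * `|b| ^+ 2 <= `|b| ^+ 2; [rewrite ler_piMl ?sqr_ge0|lra].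
have [->|b0] := eqVneq b 0.
  by rewrite addr0 subr0 normr0 expr0n /=; lra.
have na : 0 < `|a| ^+ 2 by rewrite exprn_gt0// normr_gt0.
have nb : 0 < c * `|b| ^+ 2 by rewrite mulr_gt0// exprn_gt0// normr_gt0.
pose S := `|a| ^+ 2 + c * `|b| ^+ 2; have S0 : 0 < S by rewrite addr_gt0.
pose s := `|a| ^+ 2 / S; pose t := c * `|b| ^+ 2 / S.
have s0 : 0 < s by rewrite divr_gt0.
have t0 : 0 < t by rewrite divr_gt0.
have st : s + t = 1 by rewrite -mulrDl mulfV// gt_eqF.
have sE : `|a| ^+ 2 = s * S by rewrite /s divfK// gt_eqF.
have tE : c * `|b| ^+ 2 = t * S by rewrite /t divfK// gt_eqF.
clearbody s t.
have int_le : s `^ (1 - r) * `|a| `^ p + t `^ (1 - r) * c `^ r * `|b| `^ p <=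
    (`|a + b| `^ p + `|a - b| `^ p) / 2.
  apply: lift => [||x y]; rewrite ?mulr_ge0 ?powR_ge0//.
  have h := two_point x y p_gt1 p_le2; apply: le_trans h.
  have cy : 0 <= c * y ^+ 2 by rewrite mulr_ge0 ?sqr_ge0 ?(ltW c0).
  have := powR_split r0 r1 s0 t0 st (sqr_ge0 x) cy.
  have sqR (z : R) : (z ^+ 2) `^ r = `|z| `^ p.
    have -> : z ^+ 2 = `|z| ^+ 2 by rewrite real_normK ?num_real.
    by rewrite -powR_mulrn// -powRrM /r mulrCA mulfV ?mulr1// pnatr_eq0.
  by rewrite powRM ?(ltW c0) ?sqr_ge0// !sqR mulrA.
have E1 : s `^ (1 - r) * `|a| `^ p = s * S `^ r.
  have -> : `|a| `^ p = (s * S) `^ r by rewrite -sq sE.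
  rewrite (powRM _ (ltW s0) (ltW S0)) mulrA -powRD ?subrK ?powRr1 ?(ltW s0)//.
  by rewrite oner_eq0.
have E2 : t `^ (1 - r) * c `^ r * `|b| `^ p = t * S `^ r.
  have -> : t `^ (1 - r) * c `^ r * `|b| `^ p = t `^ (1 - r) * (t * S) `^ r.
    by rewrite -mulrA -sq -powRM ?(ltW c0) ?sqr_ge0// tE.
  rewrite (powRM _ (ltW t0) (ltW S0)) mulrA -powRD ?subrK ?powRr1 ?(ltW t0)//.
  by rewrite oner_eq0.
have := le_trans int_le (sum_le (a + b) (a - b)).
rewrite E1 E2 -mulrDl st mul1r -/S.
move=> h; rewrite leNgt; apply/negP => lt.
move: h; rewrite leNgt => /negP; apply; apply: gt0_ltr_powR => //.
  by rewrite nnegrE divr_ge0// addr_ge0// sqr_ge0.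
by rewrite nnegrE ltW.
Qed.
End LpConvexity.

(** * Dyadic averages *)

Section DyadicIntervals.
Context (R : realType).
Local Notation mu := (lebesgue01 R).

Definition dyadic (n j : nat) : set R := `[j%:R / 2 ^+ n, j.+1%:R / 2 ^+ n[%classic.

Lemma dyadicE n j t : dyadic n j t <-> j%:R <= 2 ^+ n * t < j.+1%:R.
Proof.
by rewrite /dyadic /= in_itv /= ler_pdivrMr ?exprn_gt0// ltr_pdivlMr ?exprn_gt0// mulrC.
Qed.

Lemma measurable_dyadic n j : measurable (dyadic n j : set (measurableTypeR R)).
Proof. exact: measurable_itv. Qed.

Lemma dyadic_inj n j k t : dyadic n j t -> dyadic n k t -> j = k.
Proof.
move=> /dyadicE/andP[h1 h2] /dyadicE/andP[h3 h4].
have := le_lt_trans h1 h4; have := le_lt_trans h3 h2.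
rewrite !ltr_nat !ltnS => h5 h6; by apply/eqP; rewrite eqn_leq h5 h6.
Qed.

Lemma dyadic_split n j t :
  dyadic n j t <-> dyadic n.+1 j.*2 t \/ dyadic n.+1 j.*2.+1 t.
Proof.
rewrite !dyadicE exprS -mulrA; set s := _ * t.
have -> : j.*2.+2%:R = 2 * (j.+1)%:R :> R by rewrite -doubleS -muln2 natrM mulrC.
have -> : j.*2.+1%:R = 2 * j%:R + 1 :> R by rewrite -muln2 -natr1 natrM mulrC.
have -> : j.*2%:R = 2 * j%:R :> R by rewrite -muln2 natrM mulrC.
rewrite -natr1; split=> [/andP[h1 h2]|].
  by have [h|h] := ltP (2 * s) (2 * j%:R + 1); [left|right]; apply/andP; split; lra.
by case=> /andP[h1 h2]; apply/andP; split; lra.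
Qed.

Lemma lebesgue01_sub (A : set R) : measurable (A : set (measurableTypeR R)) ->
  A `<=` `[(0:R), 1]%classic -> mu A = lebesgue_measure A.
Proof. by move=> mA A01; rewrite -[LHS]/(lebesgue_measure (A `&` `[(0:R), 1]%classic)) setIidl. Qed.

Lemma lebesgue01T : mu [set: R] = 1%E.
Proof.
rewrite -[LHS]/(lebesgue_measure ([set: R] `&` `[(0:R), 1]%classic)) setTI.
rewrite lebesgue_measure_itv /= lte_fin ltr01.
by rewrite oppr0 adde0.
Qed.

Lemma dyadic_sub01 n j : (j < 2 ^ n)%N -> dyadic n j `<=` `[(0:R), 1]%classic.
Proof.
move=> jn t /dyadicE/andP[h1 h2]; rewrite /= in_itv /=; apply/andP; split.
  by rewrite -(pmulr_rge0 _ (exprn_gt0 n (ltr0Sn R 1))) (le_trans _ h1).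
rewrite -(ler_pM2l (exprn_gt0 n (ltr0Sn R 1))) mulr1 (le_trans (ltW h2))//.
by rewrite -natrX ler_nat.
Qed.

Lemma lebesgue01_dyadic n j : (j < 2 ^ n)%N -> mu (dyadic n j) = (2 ^- n)%:E.
Proof.
move=> jn; rewrite lebesgue01_sub; [|exact: measurable_dyadic|exact: dyadic_sub01].
rewrite lebesgue_measure_itv /= lte_fin ltr_pM2r ?invr_gt0 ?exprn_gt0// ltr_nat ltnSn.
by rewrite -EFinB -mulrBl -natr1 addrC addKr mul1r.
Qed.

Lemma dyadic_sum (V : nmodType) n t :
  (exists2 k : 'I_(2 ^ n), dyadic n k t & forall F : 'I_(2 ^ n) -> V,
    \sum_(j < 2 ^ n) (if t \in dyadic n j then F j else 0) = F k) \/
  forall F : 'I_(2 ^ n) -> V,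
    \sum_(j < 2 ^ n) (if t \in dyadic n j then F j else 0) = 0.
Proof.
have [[k kt]|nk] := pselect (exists k : 'I_(2 ^ n), dyadic n k t).
  left; exists k => // F; rewrite (bigD1 k)//= mem_set// big1 ?addr0// => j jk.
  case: ifPn => //; rewrite inE => jt; move: jk.
  by rewrite -(inj_eq val_inj) /= (dyadic_inj jt kt) eqxx.
right=> F; rewrite big1// => j _; case: ifPn => //; rewrite inE => jt.
by case: nk; exists j.
Qed.

End DyadicIntervals.

Section DyadicAverages.
Context (R : realType) (p : R) (p1 : 1 <= p).
Local Notation mu := (lebesgue01 R).
Local Notation Lp := (Lp01 p1).
Local Notation Lf := (LfunType mu (p1 : (1 <= p%:E)%E)).

Let p0 : 0 < p. Proof. exact: lt_le_trans p1. Qed.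

Lemma Lf_measurable (f : Lf) : measurable_fun [set: measurableTypeR R] f.
Proof. exact: (@measurable_funPT _ _ _ _ f). Qed.

Lemma Lf_integrable (f : Lf) D : measurable (D : set (measurableTypeR R)) ->
  mu.-integrable D (EFin \o f).
Proof.
move=> mD; apply: (@integrableS _ _ _ _ setT) => //.
apply/Lfun1_integrable; apply: (@Lfun_subset _ _ _ mu 1 p%:E) => //.
- by rewrite lebesgue01T.
- exact: LfunP.
Qed.

Lemma indic_dyadic_Lfun n j : (\1_(dyadic n j) : R -> R) \in Lfun mu p%:E.
Proof.
rewrite inE; apply/andP; split; rewrite inE /=.
  exact: measurable_indic (@measurable_dyadic R n j).
rewrite /finite_norm unlock poweR_lty//.
rewrite (@eq_integral _ (measurableTypeR R) R mu setT
  (fun x => (\1_(dyadic n j) x)%:E)); last first.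
  move=> t _ /=; rewrite indicE; case: (t \in _) => /=.
    by rewrite normr1 powR1.
  by rewrite normr0 powR0 ?gt_eqF.
rewrite integral_indic//; last exact: measurable_dyadic.
apply: (@le_lt_trans _ _ (mu setT)); last by rewrite lebesgue01T ltry.
by apply: le_measure; rewrite ?inE// setIT; exact: measurable_dyadic.
Qed.

Definition dyadic_step n j : Lf := Lfun_Sub (p1 : (1 <= p%:E)%E) (indic_dyadic_Lfun n j).

Definition dyadic_mean n j (x : Lp) : R :=
  2 ^+ n * \int[mu]_(t in dyadic n j) (Lp_repr x t).

Lemma dyadic_mean_class n j f :
  dyadic_mean n j (Lp_class f) = 2 ^+ n * \int[mu]_(t in dyadic n j) f t.
Proof.
congr (_ * fine _); apply: ae_eq_integral.
- exact: measurable_dyadic.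
- by apply/measurable_EFinP; apply: measurable_funTS; exact: Lf_measurable.
- by apply/measurable_EFinP; apply: measurable_funTS; exact: Lf_measurable.
by apply: filterS (Lp_repr_class f) => t h _; rewrite h.
Qed.

Lemma dyadic_mean_linear n j : linear (dyadic_mean n j : Lp -> R^o).
Proof.
move=> a; elim/Lp_ind => f; elim/Lp_ind => g.
have mI := @measurable_dyadic R n j.
rewrite -[a *: Lp_class f]/(Lp_scale a _) Lp_scale_class.
rewrite [_ + _](Lp_add_class (a *: f) g) !dyadic_mean_class.
rewrite RintegralD//; [|exact: Lf_integrable|exact: Lf_integrable].
rewrite RintegralZl//; last exact: Lf_integrable.
by rewrite mulrDr mulrCA.
Qed.

HB.instance Definition _ n j := GRing.isLinear.Build R Lp R^o _ (dyadic_mean n j)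
  (dyadic_mean_linear n j).

Lemma dyadic_mean_split n j x :
  dyadic_mean n j x = (dyadic_mean n.+1 j.*2 x + dyadic_mean n.+1 j.*2.+1 x) / 2.
Proof.
rewrite /dyadic_mean.
have -> : dyadic n j = dyadic n.+1 j.*2 `|` dyadic n.+1 j.*2.+1 :> set R.
  by apply/seteqP; split=> t /dyadic_split.
rewrite Rintegral_setU.
- by rewrite -mulrDr exprS; field.
- exact: measurable_dyadic.
- exact: measurable_dyadic.
- by apply: Lf_integrable; apply: measurableU; exact: measurable_dyadic.
by apply/disj_setPS => t [h1 h2]; have := dyadic_inj h1 h2; lia.
Qed.

Lemma dyadic_mean_step n j k : (k < 2 ^ n)%N ->
  dyadic_mean n k (Lp_class (dyadic_step n j)) = (k == j)%:R.
Proof.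
move=> kn; rewrite dyadic_mean_class.
have [k_eq|kj] := eqVneq k j.
  rewrite (@eq_Rintegral _ _ _ _ _ (fun=> 1)); last first.
    by move=> t; rewrite k_eq => tj /=; rewrite indicE tj.
  rewrite Rintegral_cst; last exact: measurable_dyadic.
  by move: kn; rewrite k_eq => kn; rewrite lebesgue01_dyadic//= mul1r mulfV ?expf_neq0.
rewrite (@eq_Rintegral _ _ _ _ _ (fun=> 0)); last first.
  move=> t; rewrite inE => tk /=; rewrite indicE memNset// => tj.
  by move: kj; rewrite (dyadic_inj tk tj) eqxx.
by rewrite Rintegral_cst ?mul0r ?mulr0//; exact: measurable_dyadic.
Qed.

Definition dyadic_vec n j : Lp := Lp_class (dyadic_step n j).

Lemma dyadic_vec_split n j :
  dyadic_vec n j = dyadic_vec n.+1 j.*2 + dyadic_vec n.+1 j.*2.+1.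
Proof.
rewrite [RHS](Lp_add_class (dyadic_step _ _) (dyadic_step _ _)).
apply/Lp_class_eq; apply: aeW => t _ /=; rewrite -[RHS]/(_ t + _ t) /= !indicE.
have := @dyadic_split R n j t; have [jt|jt] := pselect (dyadic n j t).
  move=> [/(_ jt)[h|h] _]; rewrite (mem_set jt) (mem_set h) memNset ?addr0 ?add0r// => h';
    by have := dyadic_inj h h'; lia.
move=> [_ H]; rewrite !memNset ?addr0// => h; apply: jt; apply: H; by [left|right].
Qed.

Definition dyadic_proj n (x : Lp) : Lp :=
  \sum_(j < 2 ^ n) (dyadic_mean n j x : R) *: dyadic_vec n j.

Lemma dyadic_proj_linear n : linear (dyadic_proj n).
Proof.
move=> a x y; rewrite /dyadic_proj scaler_sumr -big_split /=; apply: eq_bigr => j _.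
by rewrite linearP scalerDl scalerA.
Qed.

HB.instance Definition _ n := GRing.isLinear.Build R Lp Lp _ (dyadic_proj n)
  (dyadic_proj_linear n).

Lemma dyadic_mean_proj n m j x : (n <= m)%N -> (j < 2 ^ n)%N ->
  dyadic_mean n j (dyadic_proj m x) = dyadic_mean n j x.
Proof.
move=> /subnKC <-; move: (m - n)%N => {m} k.
elim: k n j => [|k IH] n' j jn.
  rewrite addn0 /dyadic_proj linear_sum (bigD1 (Ordinal jn))//= big1 => [|i ij].
    by rewrite linearZ_LR /= dyadic_mean_step// eqxx addr0 /GRing.scale /= mulr1.
  rewrite linearZ_LR /= dyadic_mean_step// [j == i]eq_sym -(inj_eq val_inj) in ij *.
  by rewrite (negbTE ij) /GRing.scale /= mulr0.
have [h1 h2] : (j.*2 < 2 ^ n'.+1)%N /\ (j.*2.+1 < 2 ^ n'.+1)%N.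
  by rewrite expnS mul2n; split; lia.
by rewrite dyadic_mean_split addnS -addSn !IH// -dyadic_mean_split.
Qed.

Lemma dyadic_proj_vec n m j : (n <= m)%N -> (j < 2 ^ n)%N ->
  dyadic_proj m (dyadic_vec n j) = dyadic_vec n j.
Proof.
move=> /subnKC <-; move: (m - n)%N => {m} k.
elim: k n j => [|k IH] n' j jn.
  rewrite addn0 /dyadic_proj (bigD1 (Ordinal jn))//= big1 => [|i ij].
    by rewrite dyadic_mean_step// eqxx scale1r addr0.
  rewrite dyadic_mean_step//; move: ij; rewrite -(inj_eq val_inj) /= => /negbTE ->.
  by rewrite scale0r.
have [h1 h2] : (j.*2 < 2 ^ n'.+1)%N /\ (j.*2.+1 < 2 ^ n'.+1)%N.
  by rewrite expnS mul2n; split; lia.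
by rewrite dyadic_vec_split (linearD (dyadic_proj _)) /= addnS -addSn !IH.
Qed.

Lemma dyadic_proj_le_proj n m x : (n <= m)%N ->
  dyadic_proj n (dyadic_proj m x) = dyadic_proj n x.
Proof.
by move=> nm; apply: eq_bigr => j _; rewrite dyadic_mean_proj.
Qed.

Lemma dyadic_proj_ge_proj n m x : (n <= m)%N ->
  dyadic_proj m (dyadic_proj n x) = dyadic_proj n x.
Proof.
move=> nm; rewrite {2}/dyadic_proj linear_sum; apply: eq_bigr => j _.
by rewrite (linearZ_LR (dyadic_proj m)) /= dyadic_proj_vec.
Qed.

End DyadicAverages.

Section DyadicContraction.
Context (R : realType) (p : R) (p1 : 1 <= p) (p_gt1 : 1 < p).
Local Notation mu := (lebesgue01 R).
Local Notation Lp := (Lp01 p1).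
Local Notation Lf := (LfunType mu (p1 : (1 <= p%:E)%E)).

Let p0 : 0 < p. Proof. exact: lt_le_trans p1. Qed.

Lemma Lf_powR_integrable (f : Lf) D : measurable (D : set (measurableTypeR R)) ->
  mu.-integrable D (EFin \o (fun t => `|f t| `^ p)).
Proof.
move=> mD; apply: (@integrableS _ _ _ _ setT) => //.
by apply: Lfun_integrable => //; exact: LfunP.
Qed.

Lemma Lp_norm_powR_Rintegral (f : Lf) :
  `|Lp_class f : Lp| `^ p = \int[mu]_t (`|f t| `^ p).
Proof. by rewrite /Rintegral -Lp_norm_powR. Qed.

(** Jensen's inequality.  Young's inequality for |f| and the constant m^(p - 1),
    where m is the mean, integrates to it. *)
Lemma dyadic_mean_powR_le n j f : (j < 2 ^ n)%N ->
  `|dyadic_mean n j (Lp_class f : Lp)| `^ p <=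
  2 ^+ n * \int[mu]_(t in dyadic n j) (`|f t| `^ p).
Proof.
move=> jn; set m := `|_|; have mI := @measurable_dyadic R n j.
have n0 : 0 < 2 ^+ n :> R by rewrite exprn_gt0.
have intf := Lf_integrable f mI.
have intnf : mu.-integrable (dyadic n j) (EFin \o (fun t => `|f t|)).
  exact: (integrable_norm intf).
have intpf := Lf_powR_integrable f mI.
have mle : m <= 2 ^+ n * \int[mu]_(t in dyadic n j) `|f t|.
  rewrite /m dyadic_mean_class normrM gtr0_norm// ler_pM2l//.
  exact: le_normr_Rintegral.
have m0 : 0 <= m := normr_ge0 _.
pose q := p / (p - 1).
have q0 : 0 < q by rewrite divr_gt0// subr_gt0.
have pq : p^-1 + q^-1 = 1 by rewrite /q; field; rewrite !gt_eqF ?subr_gt0.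
pose K := m `^ p / q.
have young t : m `^ (p - 1) * `|f t| <= p^-1 * `|f t| `^ p + K.
  have := conjugate_powR (normr_ge0 (f t)) (powR_ge0 m (p - 1)) p0 q0 pq.
  by rewrite -powRrM /K /q [(p - 1) * _]mulrCA mulfV ?gt_eqF ?subr_gt0// mulr1 mulrC [_ / p]mulrC.
have intK : mu.-integrable (dyadic n j) (EFin \o cst K).
  apply/integrableP; split; first by apply/measurable_EFinP.
  rewrite (eq_integral (cst `|K|%:E)); last by [].
  by rewrite integral_cst// lebesgue01_dyadic// -EFinM ltry.
have int1 : mu.-integrable (dyadic n j) (EFin \o (fun t => m `^ (p - 1) * `|f t|)).
  exact: (integrableZl mI (m `^ (p - 1)) intnf).
have int2 : mu.-integrable (dyadic n j) (EFin \o (fun t => p^-1 * `|f t| `^ p)).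
  exact: (integrableZl mI p^-1 intpf).
have : \int[mu]_(t in dyadic n j) (m `^ (p - 1) * `|f t|) <=
       \int[mu]_(t in dyadic n j) (p^-1 * `|f t| `^ p + K).
  apply: le_Rintegral => //.
  exact: (integrableD mI int2 intK).
rewrite RintegralZl// RintegralD//.
rewrite RintegralZl// Rintegral_cst// lebesgue01_dyadic//=.
set If := \int[mu]_(t in _) _; set Ip := \int[mu]_(t in _) _ => h.
have h2 : m `^ p / 2 ^+ n <= m `^ (p - 1) * If.
  rewrite -(mulr_powRB1 m0 p0) (mulrC m) -mulrA ler_wpM2l ?powR_ge0//.
  by rewrite ler_pdivrMr// mulrC.
have h3 : m `^ p / 2 ^+ n * (1 - q^-1) <= p^-1 * Ip.
  move: (le_trans h2 h); rewrite /K => h4.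
  rewrite mulrBr mulr1 lerBlDr (le_trans h4)// lerD2l.
  by rewrite mulrAC.
have -> : m `^ p = p * 2 ^+ n * (m `^ p / 2 ^+ n * (1 - q^-1)).
  have -> : 1 - q^-1 = p^-1 by rewrite -pq addrK.
  by field; rewrite !gt_eqF.
apply: (@le_trans _ _ (p * 2 ^+ n * (p^-1 * Ip))).
  by rewrite ler_wpM2l// mulr_ge0// ltW.
by rewrite mulrCA !mulrA mulVf ?gt_eqF// mul1r.
Qed.

Lemma sum_Rintegral_dyadic_le n (h : R -> R) : (forall t, 0 <= h t) ->
  mu.-integrable setT (EFin \o h) ->
  \sum_(j < 2 ^ n) \int[mu]_(t in dyadic n j) h t <= \int[mu]_t h t.
Proof.
move=> h0 inth.
pose J N : set (measurableTypeR R) := `[(0:R), N%:R / 2 ^+ n[%classic.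
have mJ N : measurable (J N) by exact: measurable_itv.
have intJ A : measurable (A : set (measurableTypeR R)) -> mu.-integrable A (EFin \o h).
  by move=> mA; apply: (@integrableS _ _ _ _ setT).
have key N : \sum_(j < N) \int[mu]_(t in dyadic n j) h t = \int[mu]_(t in J N) h t.
  elim: N => [|N IH].
    rewrite big_ord0 (_ : J 0%N = set0) ?Rintegral_set0//.
    apply/seteqP; split=> t //=; rewrite /J /= in_itv /= mul0r => /andP[h1].
    by rewrite ltNge h1.
  rewrite big_ord_recr /= IH.
  have -> : J N.+1 = J N `|` dyadic n N.
    apply/seteqP; split=> t; rewrite /J /dyadic /= !in_itv /=.
      by move=> /andP[t0 tN]; case: (ltP t (N%:R / 2 ^+ n)) => h1; [left|right]; apply/andP.
    have hN : N%:R / 2 ^+ n <= N.+1%:R / 2 ^+ n :> R.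
      by rewrite ler_pM2r ?invr_gt0 ?exprn_gt0// ler_nat.
    case=> /andP[h1 h2]; apply/andP; split=> //; first exact: lt_le_trans hN.
    by rewrite (le_trans _ h1)// divr_ge0// exprn_ge0.
  have mI := @measurable_dyadic R n N.
  rewrite Rintegral_setU//; first by apply: intJ; exact: measurableU.
  apply/disj_setPS => t []; rewrite /J /dyadic /= !in_itv /= => /andP[_ h1] /andP[h2 _].
  by move: h1; rewrite ltNge h2.
rewrite key /Rintegral fine_le//.
- by apply: integrable_fin_num => //; exact: intJ.
- by apply: integrable_fin_num.
apply: ge0_subset_integral => //.
  by case/integrableP : inth.
by move=> t _; rewrite lee_fin.
Qed.

Lemma dyadic_proj_class n (f : Lf) : exists2 g : Lf,
  dyadic_proj n (Lp_class f : Lp) = Lp_class g &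
  forall t, g t = \sum_(j < 2 ^ n)
    (if t \in dyadic n j then dyadic_mean n j (Lp_class f : Lp) else 0).
Proof.
pose c (j : 'I_(2 ^ n)) : R := dyadic_mean n j (Lp_class f : Lp).
exists (\sum_(j < 2 ^ n) c j *: dyadic_step p1 n j).
  rewrite (big_morph (fun h : Lf => Lp_class h : Lp)
    (fun g h => esym (Lp_add_class g h)) (erefl _)).
  by apply: eq_bigr => j _; exact: Lp_scale_class.
move=> t; rewrite (big_morph (fun h : Lf => h t) (id1 := 0) (op1 := +%R))//.
apply: eq_bigr => j _; rewrite -[LHS]/(c j * \1_(dyadic n j) t) indicE.
by case: (t \in _); rewrite ?mulr1 ?mulr0.
Qed.

Lemma dyadic_proj_le n (x : Lp) : `|dyadic_proj n x| <= `|x|.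
Proof.
elim/Lp_ind: x => f; have [g -> gE] := dyadic_proj_class n f.
pose c (j : 'I_(2 ^ n)) : R := dyadic_mean n j (Lp_class f : Lp).
rewrite leNgt; apply/negP => lt.
have : `|Lp_class f : Lp| `^ p < `|Lp_class g : Lp| `^ p.
  by apply: gt0_ltr_powR; rewrite ?nnegrE.
apply/negP; rewrite -leNgt.
have -> : `|Lp_class g : Lp| `^ p = \sum_(j < 2 ^ n) `|c j| `^ p / 2 ^+ n.
  apply: EFin_inj; rewrite Lp_norm_powR.
  rewrite (@eq_integral _ (measurableTypeR R) R mu setT
    (fun t => \sum_(j < 2 ^ n) ((`|c j| `^ p)%:E * (\1_(dyadic n j) t)%:E)))%E; last first.
    move=> t _; rewrite gE.
    have -> : (\sum_(j < 2 ^ n) ((`|c j| `^ p)%:E * (\1_(dyadic n j) t)%:E) =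
        (\sum_(j < 2 ^ n) (if t \in dyadic n j then `|c j| `^ p else 0)%R)%:E)%E.
      rewrite -sumEFin; apply: eq_bigr => j _; rewrite indicE -EFinM.
      by case: (t \in _); rewrite ?mulr1 ?mulr0.
    by have [[k _ H]|H] := dyadic_sum R n t; rewrite !H// normr0 powR0// gt_eqF.
  rewrite ge0_integral_sum//.
  - rewrite -sumEFin; apply: eq_bigr => j _.
    rewrite ge0_integralZl//.
    + rewrite integral_indic//; last exact: measurable_dyadic.
      by rewrite setIT lebesgue01_dyadic// -EFinM.
    + apply/measurable_EFinP; exact: measurable_indic (@measurable_dyadic R n j).
  - move=> j; apply: measurable_funeM; apply/measurable_EFinP.
    exact: measurable_indic (@measurable_dyadic R n j).
rewrite Lp_norm_powR_Rintegral.
apply: le_trans (sum_Rintegral_dyadic_le n _ _).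
- apply: ler_sum => j _; rewrite ler_pdivrMr ?exprn_gt0// mulrC.
  exact: dyadic_mean_powR_le.
- by move=> t; exact: powR_ge0.
- exact: Lf_powR_integrable.
Qed.

End DyadicContraction.

(** * Convergence of the dyadic averages *)

Section LowerLimits.
Context (R : realType).

Lemma powR_le_limn_einf (p y : R) (u : nat -> R) : 0 < p -> 0 <= y ->
  u @ \oo --> y ->
  ((y `^ p)%:E <= limn_einf (fun n => (u n `^ p)%:E))%E.
Proof.
move=> p0; rewrite le_eqVlt => /predU1P[<- _|y0 uy].
  rewrite powR0 ?gt_eqF// limn_einf_lim; apply: lime_ge; first exact: is_cvg_einfs.
  apply: nearW => n; apply: le_ereal_inf_tmp => _ [m _ <-].
  by rewrite lee_fin powR_ge0.
have cy : {for y, continuous (fun x : R => x `^ p)}.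
  apply: differentiable_continuous; apply/derivable1_diffP.
  by apply: derivable_powR; rewrite in_itv /= y0.
have : (EFin \o (fun n => u n `^ p)) @ \oo --> (y `^ p)%:E.
  apply: cvg_EFin; first by apply: nearW.
  exact: (cvg_comp _ _ uy cy).
by move=> /cvg_limn_einf_sup[-> _].
Qed.

Lemma lt_limn_einf (u : nat -> R) (a : R) :
  (a%:E < limn_einf (fun n => (u n)%:E))%E ->
  exists N, forall n, (N <= n)%N -> a < u n.
Proof.
rewrite limn_einf_lim (cvg_lim _ (@cvg_einfs_sup _ _))// => /ereal_sup_gt[_ [N _ <-] aN].
exists N => n Nn; rewrite -lte_fin (lt_le_trans aN)//.
by apply: ereal_inf_lbound; exists n.
Qed.

End LowerLimits.

Section DyadicConvergence.
Context (R : realType) (p : R) (p1 : 1 <= p).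
Local Notation mu := (lebesgue01 R).
Local Notation leb := (@lebesgue_measure R).
Local Notation Lp := (Lp01 p1).
Local Notation Lf := (LfunType mu (p1 : (1 <= p%:E)%E)).

(** The dyadic interval of level [n] around [t], for every real [t], so that
    these intervals shrink nicely to [t] without any case distinction. *)
Definition dyadic_nbhs (t : R) (n : nat) : set R :=
  `[(Num.floor (2 ^+ n * t))%:~R / 2 ^+ n, (Num.floor (2 ^+ n * t) + 1)%:~R / 2 ^+ n[%classic.

Lemma nicely_shrinking_dyadic t : nicely_shrinking t (dyadic_nbhs t).
Proof.
have e0 n : 0 < 2^-1 ^+ n :> R by rewrite exprn_gt0.
split; first by move=> n; exact: measurable_itv.
exists (2, fun n => PosNum (e0 n)); split => //=.
- apply: cvg_expr; rewrite ger0_norm ?invr_ge0//; lra.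
- move=> n s; rewrite /dyadic_nbhs /ball /= in_itv /=.
  have n0 : 0 < 2 ^+ n :> R by rewrite exprn_gt0.
  rewrite ler_pdivrMr// ltr_pdivlMr// => /andP[h1 h2].
  have := floor_itv (2 ^+ n * t) => /andP[h3 h4].
  rewrite exprVn -(ltr_pM2l n0) mulfV ?gt_eqF//.
  rewrite -[X in X * _](gtr0_norm n0) -normrM mulrBr ltr_norml.
  move: h1 h2 h3 h4; rewrite ![s * _]mulrC intrD; set k := _%:~R; set a := _ * s; set b := _ * t.
  by move=> *; apply/andP; split; lra.
- move=> n; rewrite lebesgue_measure_ball; last exact: ltW.
  rewrite lebesgue_measure_itv /= lte_fin.
  have n0 : 0 < 2 ^+ n :> R by rewrite exprn_gt0.
  rewrite ltr_pM2r ?invr_gt0// ltr_int ltrDl ltr01 -EFinB -mulrBl.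
  by rewrite intrD addrC addKr mul1r -EFinM lee_fin exprVn mulr_natl.
Qed.

Lemma dyadic_nbhsE n j t : dyadic n j t -> dyadic_nbhs t n = dyadic n j.
Proof.
move=> /dyadicE/andP[h1 h2].
have fj : Num.floor (2 ^+ n * t) = j%:Z.
  by apply: floor_def; rewrite intrD -[(j%:Z)%:~R]/(j%:R : R) natr1 h1.
by rewrite /dyadic_nbhs /dyadic fj intrD -[(j%:Z)%:~R]/(j%:R : R) natr1.
Qed.

Lemma ex_dyadic n (t : R) : 0 <= t -> t < 1 -> exists k : 'I_(2 ^ n), dyadic n k t.
Proof.
move=> t0 t1; have n0 : 0 < 2 ^+ n :> R by rewrite exprn_gt0.
have s0 : 0 <= 2 ^+ n * t by rewrite mulr_ge0// ltW.
have /andP[h1 h2] := Num.Theory.truncn_itv s0.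
have kn : (Num.trunc (2 ^+ n * t) < 2 ^ n)%N.
  rewrite -(ltr_nat R) (le_lt_trans h1)// natrX -[ltRHS]mulr1 ltr_pM2l//.
by exists (Ordinal kn); apply/dyadicE; rewrite h1 h2.
Qed.

Lemma integral_lebesgue01 (A : set R) (f : R -> \bar R) :
  measurable (A : set (measurableTypeR R)) -> A `<=` `[(0:R), 1]%classic ->
  (\int[mu]_(t in A) f t = \int[leb]_(t in A) f t)%E.
Proof.
move=> mA A01; apply: eq_measure_integral => B mB BA.
apply: lebesgue01_sub => //; exact: subset_trans A01.
Qed.

Lemma locally_integrable_Lf (f : Lf) :
  locally_integrable setT (f \_ `[(0:R), 1]%classic).
Proof.
have mI : measurable (`[(0:R), 1]%classic : set (measurableTypeR R)).
  exact: measurable_itv.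
apply: open_integrable_locally; first exact: openT.
have -> : EFin \o (f \_ `[(0:R), 1]) = (EFin \o f) \_ `[(0:R), 1].
  by rewrite restrict_EFin.
apply/(integrable_mkcond _ mI).1.
have /integrableP[mf intf] := Lf_integrable f mI.
by apply/integrableP; split=> //; rewrite -integral_lebesgue01.
Qed.

(** The half-open dyadic intervals in [0, 1] miss the point 1, which is
    discarded as a null set. *)
Lemma ae_lebesgue01 (P : R -> Prop) : {ae leb, forall t, P t} ->
  {ae mu, forall t, [/\ 0 <= t, t < 1 & P t]}.
Proof.
move=> [N [mN N0 PN]].
have m1 : measurable ([set (1:R)] : set (measurableTypeR R)) by exact: measurable_set1.
have mI : measurable (`[(0:R), 1]%classic : set (measurableTypeR R)).
  exact: measurable_itv.
exists (N `|` [set 1] `|` ~` `[(0:R), 1]%classic); split.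
- by apply: measurableU; [exact: measurableU|exact: measurableC].
- apply/eqP; rewrite eq_le measure_ge0 andbT.
  rewrite -[leLHS]/(leb ((N `|` [set 1] `|` ~` `[(0:R), 1]%classic) `&` `[(0:R), 1]%classic)).
  rewrite setIUl setICl setU0.
  apply: (@le_trans _ _ (leb (N `|` [set 1]))).
    apply: le_measure; rewrite ?inE//; last exact: measurableU.
    by apply: measurableI => //; exact: measurableU.
  apply: (le_trans (measureU2 _ _ _)) => //.
  rewrite -[leLHS]/(leb N + leb [set (1%R : R)])%E.
  by rewrite N0 add0e lebesgue_measure_set1.
move=> t /= H; have [t01|] := pselect (`[(0:R), 1]%classic t); last by right.
left; have [->|t1] := eqVneq t 1; first by right.
left; apply: PN => /= Pt; apply: H.
move: t01; rewrite /= in_itv /= => /andP[t0 t1']; split=> //.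
by rewrite lt_neqAle t1.
Qed.

(** Lebesgue's differentiation theorem, the values of the averages at [t] being
    the means over the dyadic intervals around [t]. *)
Lemma dyadic_proj_ae_cvg (f : Lf) (g : nat -> Lf) :
  (forall n t, g n t = \sum_(j < 2 ^ n)
    (if t \in dyadic n j then dyadic_mean n j (Lp_class f : Lp) else 0)) ->
  {ae mu, forall t, g n t @[n --> \oo] --> f t}.
Proof.
move=> gE; have loc := locally_integrable_Lf f.
have := ae_lebesgue01 (lebesgue_differentiation loc).
apply: (@filterS _ _ (ae_filter_ringOfSetsType mu)) => t [t0 t1 pt].
have := nice_lebesgue_differentiation nicely_shrinking_dyadic loc pt.
have t01 : t \in `[(0:R), 1]%classic by rewrite inE /= in_itv /= t0 ltW.
rewrite patchE t01 (_ : (fun n => _) = EFin \o (fun n => g n t)); last first.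
  apply/funext => n /=; have [k kt] := ex_dyadic n t0 t1.
  have mI := @measurable_dyadic R n k; have kn := ltn_ord k.
  rewrite (dyadic_nbhsE kt) -integral_lebesgue01//; last exact: dyadic_sub01.
  rewrite -lebesgue01_sub//; last exact: dyadic_sub01.
  rewrite lebesgue01_dyadic// gE.
  have [[k' kt' ->]|H] := dyadic_sum R n t; last first.
    have := H (fun=> 1); rewrite (bigD1 k)//= mem_set// => /eqP.
    rewrite paddr_eq0 ?oner_eq0// sumr_ge0// => j _; by case: ifP.
  rewrite (dyadic_inj kt' kt) dyadic_mean_class inver.
  rewrite invr_eq0 expf_eq0 pnatr_eq0 andbF invrK EFinM; congr (_ * _)%E.
  rewrite /Rintegral fineK; last by apply: integrable_fin_num => //; exact: Lf_integrable.
  apply: eq_integral => s; rewrite inE => sk; rewrite patchE mem_set//.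
  exact: dyadic_sub01 sk.
by move=> /fine_cvg.
Qed.

End DyadicConvergence.

Section DyadicApproximation.
Context (R : realType) (p : R) (p1 : 1 <= p) (p_gt1 : 1 < p) (p_le2 : p <= 2).
Local Notation mu := (lebesgue01 R).
Local Notation Lp := (Lp01 p1).
Local Notation Lf := (LfunType mu (p1 : (1 <= p%:E)%E)).

Let p0 : 0 < p. Proof. exact: lt_le_trans p1. Qed.

(** Fatou's lemma for the p-th powers. *)
Lemma Lp_norm_lower_semicontinuous (f : Lf) (h : nat -> Lf) :
  {ae mu, forall t, h n t @[n --> \oo] --> f t} ->
  ((`|Lp_class f : Lp| `^ p)%:E <=
   limn_einf (fun n => (`|Lp_class (h n) : Lp| `^ p)%:E))%E.
Proof.
move=> hf.
have mh (k : Lf) : measurable_fun setT (fun t => (`|k t| `^ p)%:E).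
  by case/integrableP: (Lf_powR_integrable k measurableT).
have h0 n t : setT t -> (0 <= (`|h n t| `^ p)%:E)%E.
  by move=> _; rewrite lee_fin powR_ge0.
rewrite Lp_norm_powR.
rewrite (_ : (fun n => _) = (fun n => \int[mu]_(t in setT) (`|h n t| `^ p)%:E))%E; last first.
  by apply/funext => n; rewrite Lp_norm_powR.
apply: le_trans (fatou mu measurableT (fun n => mh (h n)) h0).
apply: ae_ge0_le_integral => //.
- move=> t _; rewrite limn_einf_lim; apply: lime_ge; first exact: is_cvg_einfs.
  apply: nearW => n; apply: le_ereal_inf_tmp => _ [m _ <-]; exact: h0.
- rewrite (_ : (fun t => limn_einf _) =
    (fun t => - limn_esup (fun n => - (`|h n t| `^ p)%:E))%E); last first.
    by apply/funext => t; rewrite limn_esupN oppeK.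
  apply: measurableT_comp => //.
  by apply: measurable_fun_limn_esup => n; exact: measurableT_comp.
apply: (@filterS _ _ (ae_filter_ringOfSetsType mu)) hf => t ht _.
by apply: powR_le_limn_einf => //; exact: cvg_norm.
Qed.

(** The half sums of [x] and its averages converge to [x] almost everywhere, so
    their norms are eventually above |x| - d.  The averages being contractions,
    uniform convexity then bounds the distance by a multiple of the square root
    of [d |x|]; the choice of [d] makes it less than [e]. *)
Lemma dyadic_proj_cvg (x : Lp) e : 0 < e ->
  exists N, forall n, (N <= n)%N -> `|x - dyadic_proj n x| < e.
Proof.
elim/Lp_ind: x => f e0; set x : Lp := Lp_class f.
have [F0|F0] := eqVneq `|x| 0.
  exists 0%N => n _; rewrite (le_lt_trans (ler_normB _ _))// F0 add0r.
  by rewrite (le_lt_trans (dyadic_proj_le p_gt1 n x))// F0.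
have {}F0 : 0 < `|x| by rewrite lt_neqAle eq_sym F0 /=.
have /choice[g gP] n : exists g : Lf, dyadic_proj n x = Lp_class g /\
    forall t, g t = \sum_(j < 2 ^ n)
      (if t \in dyadic n j then dyadic_mean n j (Lp_class f : Lp) else 0).
  by have [g gx gE] := dyadic_proj_class n f; exists g.
have gf := dyadic_proj_ae_cvg (fun n => (gP n).2).
pose h n : Lf := 2^-1 *: (g n + f).
have hx n : Lp_class (h n) = 2^-1 *: (dyadic_proj n x + x) :> Lp.
  by rewrite (gP n).1 -[RHS]/(Lp_scale _ (Lp_add _ _)) Lp_add_class Lp_scale_class.
have hf : {ae mu, forall t, h n t @[n --> \oo] --> f t}.
  apply: (@filterS _ _ (ae_filter_ringOfSetsType mu)) gf => t gt.
  have -> : f t = 2^-1 * (f t + f t) by field.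
  by apply: cvgMr; apply: cvgD gt _; exact: cvg_cst.
pose c := two_point_cst p; have c0 : 0 < c := two_point_cst_gt0 p_gt1.
pose d := Num.min `|x| (c * e ^+ 2 / (16 * `|x|)).
have d0 : 0 < d by rewrite lt_min F0 /=; apply: divr_gt0; apply: mulr_gt0 => //; exact: exprn_gt0.
have dx : d <= `|x| by rewrite ge_min lexx.
have dc : 16 * `|x| * d <= c * e ^+ 2.
  by rewrite mulrC -ler_pdivlMr ?mulr_gt0// ge_min lexx orbT.
have [|N HN] := @lt_limn_einf _ (fun n => `|Lp_class (h n) : Lp| `^ p) ((`|x| - d) `^ p).
  apply: lt_le_trans (Lp_norm_lower_semicontinuous hf).
  rewrite lte_fin gt0_ltr_powR ?nnegrE ?subr_ge0//.
  by rewrite ltrBlDr ltrDl.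
exists N => n /HN; rewrite hx => hN.
have {hN} hN : `|x| - d < `|2^-1 *: (dyadic_proj n x + x)|.
  rewrite ltNge; apply/negP => H; move: hN; rewrite ltNge => /negP; apply.
  by apply: ge0_ler_powR; rewrite ?nnegrE ?subr_ge0// ltW.
have := @Lp_two_convex _ _ R mu p p1 p_gt1 p_le2 (dyadic_proj n x : Lp) x.
rewrite -/c [X in c * X ^+ 2]normrZ -[`|_ - x|]distrC gtr0_norm ?invr_gt0//.
have := dyadic_proj_le p_gt1 n x.
move: hN; set y := `|2^-1 *: _|; set r := `|x - _|; set s := `|dyadic_proj n x|.
move=> hy sx cvx.
have [s0 y0 r0] : [/\ 0 <= s, 0 <= y & 0 <= r] by split; exact: normr_ge0.
have s2 : s ^+ 2 <= `|x| ^+ 2 by rewrite ler_sqr ?nnegrE.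
have y2 : (`|x| - d) ^+ 2 <= y ^+ 2 by rewrite ler_sqr ?nnegrE ?subr_ge0// ltW.
have cr : c * r ^+ 2 <= 8 * `|x| * d.
  by have := sqr_ge0 d; move: cvx s2 y2; rewrite !exprMn; lra.
have : c * r ^+ 2 < c * e ^+ 2.
  have xd : 0 < `|x| * d by rewrite mulr_gt0.
  by lra.
by rewrite ltr_pM2l// ltr_sqr ?nnegrE// ltW.
Qed.

Lemma Rintegral_dyadic_le n j (h : R -> R) : (forall t, 0 <= h t) ->
  mu.-integrable setT (EFin \o h) ->
  \int[mu]_(t in dyadic n j) h t <= \int[mu]_t h t.
Proof.
move=> h0 inth; have mI := @measurable_dyadic R n j.
rewrite /Rintegral fine_le//.
- by apply: integrable_fin_num => //; apply: (integrableS measurableT).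
- exact: integrable_fin_num.
apply: ge0_subset_integral => //.
  by case/integrableP : inth.
by move=> t _; rewrite lee_fin.
Qed.

Lemma dyadic_mean_le n j (x : Lp) : (j < 2 ^ n)%N ->
  `|dyadic_mean n j x| <= 2 ^+ n * `|x|.
Proof.
elim/Lp_ind: x => f jn; set x : Lp := Lp_class f.
have n1 : 1 <= 2 ^+ n :> R by rewrite exprn_ege1// ler1n.
have n0 : 0 <= 2 ^+ n :> R := le_trans ler01 n1.
rewrite leNgt; apply/negP => H.
have : (2 ^+ n * `|x|) `^ p < `|dyadic_mean n j x| `^ p.
  by apply: gt0_ltr_powR; rewrite ?nnegrE ?mulr_ge0.
apply/negP; rewrite -leNgt (le_trans (dyadic_mean_powR_le p_gt1 f jn))//.
rewrite powRM// ler_pM ?le1r_powR//.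
  by apply: Rintegral_ge0 => t _; exact: powR_ge0.
rewrite Lp_norm_powR_Rintegral; apply: Rintegral_dyadic_le.
  by move=> t; exact: powR_ge0.
exact: Lf_powR_integrable.
Qed.

Lemma dyadic_proj_coord n : exists d (e : 'I_d -> Lp) (a : 'I_d -> {linear Lp -> R^o}),
  (forall x, dyadic_proj n x = \sum_(i < d) (a i x : R) *: e i) /\
  exists2 C, 0 < C & forall i x, `|a i x : R| <= C * `|x|.
Proof.
exists (2 ^ n)%N, (fun j => dyadic_vec p1 n j), (fun j => dyadic_mean n j : {linear Lp -> R^o}).
split=> //; exists (2 ^+ n); first by rewrite exprn_gt0.
by move=> j x; exact: dyadic_mean_le.
Qed.

Definition dyadic_approximation : finite_rank_approximation Lp :=
  Build_finite_rank_approximation (dyadic_proj_le p_gt1)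
    (@dyadic_proj_le_proj _ _ _) (@dyadic_proj_ge_proj _ _ _) dyadic_proj_cvg dyadic_proj_coord.

End DyadicApproximation.

(** * The theorem *)

Theorem corollary3p11 (R : realType) (p1 p2 : R)
    (p1_gt1 : 1 < p1) (p1_le2 : p1 <= 2) (p2_gt1 : 1 < p2) (p2_le2 : p2 <= 2) :
  SWCG (projective_tensor (Lp01 (ltW p1_gt1)) (Lp01 (ltW p2_gt1))).
Proof.
pose c := Num.min (two_point_cst p1) (two_point_cst p2).
apply: (SWCG_projective_tensor (c := c)
  (dyadic_approximation (ltW p1_gt1) p1_gt1 p1_le2)
  (dyadic_approximation (ltW p2_gt1) p2_gt1 p2_le2)).
- by rewrite lt_min !two_point_cst_gt0.
- apply: two_convex_le (Lp_two_convex p1_gt1 p1_le2).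
    by move=> x; rewrite sqr_ge0.
  by rewrite ge_min lexx.
- apply: two_convex_le (Lp_two_convex p2_gt1 p2_le2).
    by move=> x; rewrite sqr_ge0.
  by rewrite ge_min lexx orbT.
Qed.
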